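(* Let $M$ be a smooth manifold of dimension $\geq 2$, let $M_{\mathrm{sing}}\subset M$ be a closed subset with dense complement, and let $\omega\in\Omega^2(M\setminus M_{\mathrm{sing}})$ be a closed 2-form with a singularity at $m\in M_{\mathrm{sing}}$. The singularity of $\omega$ at $m$ is removable if and only if there is a smooth function $f\in C^\infty(U)$ on a neighborhood $U$ of $m$ such that the (inhomogeneous) differential form $f e^{-\omega}$, defined on $U\setminus M_{\mathrm{sing}}$, extends to a smooth nowhere vanishing differential form on $U$.
   Context: Singularity: $\omega\in\Omega^2(M\setminus M_{\mathrm{sing}})$ has a singularity at $m\in M_{\mathrm{sing}}$ if it does not have a smooth extension to a neighborhood of $m$, where a smooth extension to a neighborhood $U$ of $m$ is a 2-form $\bar\omega\in\Omega^2((M\setminus M_{\mathrm{sing}})\cup U)$ restricting to $\omega$ on $M\setminus M_{\mathrm{sing}}$. Dirac structure: a smooth vector subbundle $L\subset TM\oplus T^*M$ that is maximally isotropic for $\langle X+\alpha,Y+\beta\rangle_+=\tfrac12(i_X\beta+i_Y\alpha)$ and closed under the Dorfman bracket $[X+\alpha,Y+\beta]=[X,Y]+\mathcal{L}_X\beta-i_Yd\alpha$. The graph is $\mathrm{Graph}(\omega)=\{X+i_X\omega\}$. Removable: a singularity of a closed 2-form $\omega\in\Omega^2(M\setminus M_{\mathrm{sing}})$ at $m$ is removable (in its graph) if the closure of $\mathrm{Graph}(\omega)$ in $TM\oplus T^*M$ is a Dirac structure over a neighborhood of $m$. The exponential is $e^{-\omega}=1-\omega+\tfrac12\omega\wedge\omega-\cdots\in\Omega^\bullet(M\setminus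 M_{\mathrm{sing}})$. ''Nowhere vanishing'' means that the inhomogeneous form is nonzero in $\wedge^\bullet T^*_xM$ at every point $x\in U$. *)

(* Defs.v *)
From HB Require Import structures.
From mathcomp Require Import all_boot all_order all_algebra.
From mathcomp Require Import all_classical all_reals all_analysis.
Import Order.TTheory GRing.Theory Num.Theory numFieldNormedType.Exports.

Set Implicit Arguments.
Unset Strict Implicit.
Unset Printing Implicit Defensive.

Local Open Scope classical_set_scope.
Local Open Scope ring_scope.

(* C^k on an open set: g is differentiable and all its directional derivatives
   are C^(k-1).  Only meant for open U; g is total, its values off U play no
   role. *)
Fixpoint Ck_on (R : realType) (V W : normedModType R) (k : nat) (U : set V)
    (g : V -> W) : Prop :=
  match k with
  | 0 => forall x, U x -> {for x, continuous g}
  | k'.+1 => (forall x, U x -> differentiable g x) /\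
             forall v, Ck_on k' U (fun x => 'D_v g x)
  end.

Definition smooth_on (R : realType) (V W : normedModType R) (U : set V)
    (g : V -> W) : Prop :=
  forall k, Ck_on k U g.

(* A smooth structure of dimension n on the topological space M: a smooth atlas
   (not required to be maximal) with a preferred chart [chart_at x] around each
   point x.  Charts and their inverses are total functions, relevant only on
   [chart_dom i] and on its image. *)
Record smooth_manifold (R : realType) (n : nat) (M : topologicalType) := {
  chart_index : Type;
  chart_dom : chart_index -> set M;
  chart : chart_index -> M -> 'rV[R]_n;
  chart_inv : chart_index -> 'rV[R]_n -> M;
  chart_at : M -> chart_index;
  chart_at_dom : forall x, chart_dom (chart_at x) x;
  chart_dom_open : forall i, open (chart_dom i);
  chart_im_open : forall i, open (chart i @` chart_dom i);
  chartK : forall i x, chart_dom i x -> chart_inv i (chart i x) = x;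
  chart_continuous : forall i x, chart_dom i x -> {for x, continuous (chart i)};
  chart_inv_continuous : forall i y, (chart i @` chart_dom i) y ->
    {for y, continuous (chart_inv i)};
  chart_compatible : forall i j,
    smooth_on (chart i @` (chart_dom i `&` chart_dom j))
              (chart j \o chart_inv i);
  manifold_hausdorff : hausdorff_space M;
  manifold_second_countable : @second_countable M }.

Section Manifold.
Context {R : realType} {n : nat} {M : topologicalType}.
Context (A : smooth_manifold R n M).

Local Notation I := (chart_index A).

(* T_xM and T_x^*M are identified with row vectors 'rV_n and column vectors
   'cV_n by means of the preferred chart [chart_at A x]; the pairing of a vector
   X with a covector a is X *m a. *)
Definition pairing (X : 'rV[R]_n) (a : 'cV[R]_n) : R := (X *m a) 0 0.

Definition gfiber : normedModType R := ('rV[R]_n * 'cV[R]_n)%type.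

(* Coordinate change from chart i to chart j at x; being a Jacobian in the
   row-vector convention, it sends X to X *m jac i j x and, contragrediently,
   a to jac j i x *m a. *)
Definition jac (i j : I) (x : M) : 'M[R]_n :=
  'J (chart j \o chart_inv i) (chart i x).

(* The total space of TM (+) T^*M. *)
Definition gtangent : Type := (M * gfiber)%type.

(* Local parametrization of TM (+) T^*M over the chart i. *)
Definition of_coords (i : I) (p : 'rV[R]_n * gfiber) : gtangent :=
  let x := chart_inv i p.1 in
  let c := chart_at A x in
  (x, (p.2.1 *m jac i c x, jac c i x *m p.2.2)).

HB.instance Definition _ := Choice.on gtangent.

(* The bundle topology: O is open iff its preimages under the local
   parametrizations are. *)
Definition gtangent_open (O : set gtangent) : Prop :=
  forall i : I, open [set p : 'rV[R]_n * gfiber |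
    (chart i @` chart_dom i) p.1 /\ O (of_coords i p)].

Lemma gtangent_openT : gtangent_open setT.
Proof.
move=> i; rewrite (_ : [set _ | _] = fst @^-1` (chart i @` chart_dom i)).
  by apply: open_comp => [p _|]; [exact: cvg_fst|exact: chart_im_open].
by apply/seteqP; split=> p //= [].
Qed.

Lemma gtangent_openI (O P : set gtangent) :
  gtangent_open O -> gtangent_open P -> gtangent_open (O `&` P).
Proof.
move=> oO oP i; have := openI (oO i) (oP i).
by congr open; apply/seteqP; split=> p /=; [case=> [[? ?] [? ?]]|case=> ? []].
Qed.

Lemma gtangent_open_bigU (J : Type) (O : J -> set gtangent) :
  (forall j, gtangent_open (O j)) -> gtangent_open (\bigcup_j O j).
Proof.
move=> oO i; rewrite (_ : [set _ | _] = \bigcup_j [set p |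
    (chart i @` chart_dom i) p.1 /\ O j (of_coords i p)]).
  by apply: bigcup_open => j _; exact: oO.
by apply/seteqP; split=> p /= => [[? [j _ ?]]|[j _ [? ?]]];
  [exists j|split=> //; exists j].
Qed.

HB.instance Definition _ := isOpenTopological.Build gtangent
  gtangent_openT gtangent_openI gtangent_open_bigU.

(* Coordinate expression in the chart i of a section of TM (+) T^*M. *)
Definition section_coords (i : I) (e : M -> gfiber) (y : 'rV[R]_n) : gfiber :=
  let x := chart_inv i y in
  let c := chart_at A x in
  ((e x).1 *m jac c i x, jac i c x *m (e x).2).

Definition smooth_section (W : set M) (e : M -> gfiber) : Prop :=
  forall i, smooth_on (chart i @` (W `&` chart_dom i)) (section_coords i e).

Definition smooth_function (W : set M) (f : M -> R) : Prop :=
  forall i : I, smooth_on (chart i @` (W `&` chart_dom i)) (f \o chart_inv i).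

(* A (not necessarily homogeneous) element a of the exterior algebra of T_x^*M
   is a function on all finite sequences of vectors: its degree k component is
   the restriction of a to sequences of size k. *)
Definition preform : Type := seq 'rV[R]_n -> R.

Definition alternating_form (a : preform) : Prop :=
  (forall s1 s2 (t : R) u v,
     a (s1 ++ (t *: u + v) :: s2) = t * a (s1 ++ u :: s2) + a (s1 ++ v :: s2)) /\
  (forall s1 s2 s3 u, a (s1 ++ u :: s2 ++ u :: s3) = 0).

Definition homogeneous (k : nat) (a : preform) : Prop :=
  forall s, size s != k -> a s = 0.

(* Coordinate expression in the chart i: the pullback by [chart_inv i]. *)
Definition form_coords (i : I) (w : M -> preform) (y : 'rV[R]_n) : preform :=
  fun s => let x := chart_inv i y in
    w x [seq v *m jac i (chart_at A x) x | v <- s].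

Definition differential_form (W : set M) (w : M -> preform) : Prop :=
  (forall x, W x -> alternating_form (w x)) /\
  (forall i s, smooth_on (chart i @` (W `&` chart_dom i))
                         (fun y => form_coords i w y s)).

Definition differential_kform (k : nat) (W : set M) (w : M -> preform) : Prop :=
  differential_form W w /\ forall x, W x -> homogeneous k (w x).

(* (dw)_x(v_0, ..., v_k) = \sum_i (-1)^i D_{v_i} w(v_0, ..^v_i.., v_k), the v_i
   being extended as constant vector fields in the preferred chart at x. *)
Definition exterior_derivative (w : M -> preform) (x : M) : preform :=
  fun s => let c := chart_at A x in
    \sum_(i < size s) (-1) ^+ i *
      'D_(s`_i) (fun y => form_coords c w y (take i s ++ drop i.+1 s) : R)
        (chart c x).

Definition closed_form (W : set M) (w : M -> preform) : Prop :=
  forall x, W x -> forall s, exterior_derivative w x s = 0.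

(* Number of inversions of the shuffle that moves the positions marked by b,
   in order, in front of the others. *)
Definition inversions (b : seq bool) : nat :=
  (\sum_(i < size b) \sum_(j < size b | i < j) (~~ nth false b i && nth false b j))%N.

(* Sum over shuffles, so that (a /\ b)(X, Y) = a(X) b(Y) - a(Y) b(X) for
   1-forms. *)
Definition wedge (a b : preform) : preform := fun s =>
  \sum_(m : (size s).-tuple bool)
    (-1) ^+ inversions m * a (mask m s) * b (mask (map negb m) s).

Definition unit_form : preform := fun s => (nilp s)%:R.

Definition wedge_power (a : preform) (p : nat) : preform :=
  iter p (wedge a) unit_form.

(* e^{-w} for a 2-form w at a point; the p-th power of w has degree 2p, hence
   vanishes when 2p > n. *)
Definition exp_neg (w : preform) : preform := fun s =>
  \sum_(p < n.+1) (-1) ^+ p / p`!%:R * wedge_power w p s.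

Definition isotropic_pairing (u v : gfiber) : R :=
  2^-1 * (pairing u.1 v.2 + pairing v.1 u.2).

Definition linear_subspace (N : set gfiber) : Prop :=
  N 0 /\ forall (t : R) u v, N u -> N v -> N (t *: u + v).

Definition isotropic (N : set gfiber) : Prop :=
  linear_subspace N /\ forall u v, N u -> N v -> isotropic_pairing u v = 0.

Definition maximally_isotropic (N : set gfiber) : Prop :=
  isotropic N /\ forall N', isotropic N' -> N `<=` N' -> N' = N.

Definition fiber_of (L : set gtangent) (x : M) : set gfiber :=
  [set u | L (x, u)].

Definition smooth_frame (U : set M) (r : nat) (e : 'I_r -> M -> gfiber)
    (L : set gtangent) : Prop :=
  [/\ forall k, smooth_section U (e k),
      forall y, U y -> forall c : 'I_r -> R,
        \sum_(k < r) c k *: e k y = 0 -> forall k, c k = 0 &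
      forall y, U y -> fiber_of L y =
        [set u | exists c : 'I_r -> R, u = \sum_(k < r) c k *: e k y]].

Definition smooth_subbundle (W : set M) (L : set gtangent) : Prop :=
  forall x, W x -> exists U : set M, [/\ open U, U x, U `<=` W &
    exists r (e : 'I_r -> M -> gfiber), smooth_frame U e L].

Local Notation E := 'rV[R]_n.
Local Notation Ed := 'cV[R]_n.

Definition lie_bracket (X Y : E -> E) (y : E) : E :=
  'D_(X y) Y y - 'D_(Y y) X y.

Definition basis_vector (k : 'I_n) : E := delta_mx 0 k.

(* (L_X b)_k = X(b_k) + \sum_j b_j d_k X^j *)
Definition lie_derivative (X : E -> E) (b : E -> Ed) (y : E) : Ed :=
  'D_(X y) b y + \col_k pairing ('D_(basis_vector k) X y) (b y).

(* (i_Y da)(Z) = D_Y a (Z) - D_Z a (Y) *)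
Definition contract_d (Y : E -> E) (a : E -> Ed) (y : E) : Ed :=
  'D_(Y y) a y - \col_k pairing (Y y) ('D_(basis_vector k) a y).

Definition dorfman_coords (e1 e2 : E -> gfiber) (y : E) : gfiber :=
  let X := fun z => (e1 z).1 in let a := fun z => (e1 z).2 in
  let Y := fun z => (e2 z).1 in let b := fun z => (e2 z).2 in
  (lie_bracket X Y y, lie_derivative X b y - contract_d Y a y).

(* The coordinate expression is chart independent; at x it is evaluated in the
   preferred chart, where it directly gives an element of the fiber at x. *)
Definition dorfman (e1 e2 : M -> gfiber) (x : M) : gfiber :=
  let c := chart_at A x in
  dorfman_coords (section_coords c e1) (section_coords c e2) (chart c x).

Definition section_of (W : set M) (L : set gtangent) (e : M -> gfiber) : Prop :=
  smooth_section W e /\ forall x, W x -> L (x, e x).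

Definition dirac_structure (W : set M) (L : set gtangent) : Prop :=
  [/\ smooth_subbundle W L,
      forall x, W x -> maximally_isotropic (fiber_of L x) &
      forall e1 e2, section_of W L e1 -> section_of W L e2 ->
        forall x, W x -> L (x, dorfman e1 e2 x)].

Definition graph (W : set M) (w : M -> preform) : set gtangent :=
  [set e | W e.1 /\ forall Y, pairing Y e.2.2 = w e.1 [:: e.2.1; Y]].

Definition has_singularity (Msing : set M) (w : M -> preform) (m : M) : Prop :=
  Msing m /\
  ~ exists U (wbar : M -> preform), [/\ open U, U m,
      differential_kform 2 (~` Msing `|` U) wbar &
      forall x, ~ Msing x -> wbar x = w x].

Definition removable (Msing : set M) (w : M -> preform) (m : M) : Prop :=
  exists W : set M, [/\ open W, W m &
    dirac_structure W (closure (graph (~` Msing) w))].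

End Manifold.

(* Main.v *)
From HB Require Import structures.
Require Import Defs.
From mathcomp Require Import all_boot all_order all_algebra.
From mathcomp Require Import all_classical all_reals all_analysis.
From mathcomp Require Import ring lra.
Import Order.TTheory GRing.Theory Num.Theory numFieldNormedType.Exports.

Set Implicit Arguments.
Unset Strict Implicit.
Unset Printing Implicit Defensive.

Local Open Scope classical_set_scope.
Local Open Scope ring_scope.

(* Over a regular point the graph of w is the annihilator of the spinor
   e^{-w}: i_X e^{-w} + a /\ e^{-w} = 0 if and only if a = i_X w.

   If the closure of the graph is Dirac near m, its fiber at m is transversal
   to the coordinate Lagrangian spanned by the d/dx^i with i in S and the dx^j
   with j not in S, for a suitable S.  In a frame normalized with respect to S
   the annihilation equations express the component of e^{-w} along dx^T as a
   smooth multiple of its component along dx^S, by induction on the size of the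
   symmetric difference of S and T.  Hence e^{-w} divided by its dx^S-component
   extends smoothly, and f is the degree zero part of the quotient.

   Conversely, if f e^{-w} extends to rho with nonzero dx^S-component at m, then
   solving the annihilation equations, with quotients of components of rho as
   coefficients, gives a smooth frame which spans the graph over regular points.
   Isotropy of the frame extends by density, and implies that the frame spans
   the closure of the graph.  Involutivity follows from d w = 0 over regular
   points and by continuity elsewhere. *)

(** * The shuffle algebra of preforms *)

(** Over a singular point the fibre of the closure is known only as a set of limits, and [f] may
    vanish there. So each direction builds coefficients that are smooth on a whole neighbourhood,
    identifies them with graph or spinor data at regular points only, and carries identities to
    singular points by density.

    The set S is an affine chart of the Lagrangian Grassmannian: S empty is the case of the graph of
    a smooth 2-form, and a general S allows directions in which [w] blows up. Fixing S turns
    Lagrangian and spinor into finitely many coefficient functions, and the denominators are a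
    determinant or a component that is nonzero at [m], hence nearby.

    Fibres are trivialized by a preferred chart that may jump from point to point, so most of the
    argument runs in one chart around [m]. The algebra of shuffles is reduced to contraction with
    the first argument, which turns the spinor identities into inductions on argument lists. *)

Section ShuffleAlgebra.
Context {R : realType} {n : nat}.
Implicit Types (a b c w : @preform R n) (s : seq 'rV[R]_n) (u v : 'rV[R]_n).

Definition iprod v a : @preform R n := fun s => a (v :: s).
(** The grading involution. It carries the sign in the Leibniz rule for contraction, so that the
    rule makes sense for inhomogeneous preforms. *)
Definition parity a : @preform R n := fun s => (-1) ^+ size s * a s.

Lemma wedgeE k a b s : size s = k -> wedge a b s =
  \sum_(m : k.-tuple bool)
    (-1) ^+ inversions m * a (mask m s) * b (mask (map negb m) s).
Proof. by move=> <-. Qed.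

Lemma sum_tupleS k (F : seq bool -> R) :
  \sum_(m : k.+1.-tuple bool) F m =
  \sum_(m : k.-tuple bool) F (true :: m) + \sum_(m : k.-tuple bool) F (false :: m).
Proof.
rewrite (reindex (fun p : bool * k.-tuple bool => [tuple of p.1 :: p.2])) /=.
  rewrite -(pair_bigA _ (fun x (m : k.-tuple bool) => F (x :: m))) /=.
  by rewrite big_bool.
exists (fun m : k.+1.-tuple bool => (thead m, [tuple of behead m])).
  by case=> x m _; congr pair; apply: val_inj.
by move=> m _; rewrite -tuple_eta.
Qed.

(** A leading [false] is overtaken by every later [true]; a leading [true] is overtaken by
    nothing. *)
Lemma inversions_cons x (m : seq bool) :
  inversions (x :: m) = ((~~ x) * count id m + inversions m)%N.
Proof.
rewrite /inversions /= big_ord_recl /=; congr addn.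
  rewrite big_mkcond /= big_ord_recl /= add0n -sum1_count big_distrr /=.
  rewrite (big_nth false) big_mkord [RHS]big_mkcond.
  apply: eq_bigr => i _.
  by case: x; case: (nth _ _ _).
apply: eq_bigr => i _; rewrite big_mkcond big_ord_recl /= add0n [RHS]big_mkcond.
by apply: eq_bigr => j _; rewrite /bump /= !add1n ltnS.
Qed.

Lemma wedge_nil a b : wedge a b [::] = a [::] * b [::].
Proof.
rewrite /wedge /= (bigD1 [tuple]) //= big1 ?addr0.
  by rewrite /inversions big_ord0 expr0 mul1r.
by move=> m /eqP[]; exact: tuple0.
Qed.

(** Contraction is an antiderivation. The shuffles split according to the factor that receives [v];
    when it goes to [b], it passes all arguments of [a], whence [parity a]. The inductions on
    argument lists below go through this rule. *)
Lemma wedge_cons a b v s : wedge a b (v :: s) =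
  wedge (iprod v a) b s + wedge (parity a) (iprod v b) s.
Proof.
rewrite (@wedgeE (size s).+1)// (sum_tupleS _ (fun m => (-1) ^+ inversions m *
  a (mask m (v :: s)) * b (mask (map negb m) (v :: s)))) /=.
congr (_ + _); apply: eq_bigr => m _; rewrite inversions_cons //=.
by rewrite /parity /iprod mul1n exprD size_mask ?size_tuple//; ring.
Qed.

Lemma wedge_ext a a' b b' : a =1 a' -> b =1 b' -> wedge a b =1 wedge a' b'.
Proof. by move=> ea eb s; apply: eq_bigr => m _; rewrite ea eb. Qed.

Lemma wedgeDZl (t : R) a a' b s :
  wedge (fun s => t * a s + a' s) b s = t * wedge a b s + wedge a' b s.
Proof.
by rewrite /wedge big_distrr -big_split; apply: eq_bigr => m _ /=; ring.
Qed.

Lemma wedgeDZr (t : R) a b b' s :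
  wedge a (fun s => t * b s + b' s) s = t * wedge a b s + wedge a b' s.
Proof.
by rewrite /wedge big_distrr -big_split; apply: eq_bigr => m _ /=; ring.
Qed.

Lemma wedgeZl (t : R) a b s : wedge (fun s => t * a s) b s = t * wedge a b s.
Proof. by rewrite /wedge big_distrr; apply: eq_bigr => m _ /=; ring. Qed.

Lemma wedgeZr (t : R) a b s : wedge a (fun s => t * b s) s = t * wedge a b s.
Proof. by rewrite /wedge big_distrr; apply: eq_bigr => m _ /=; ring. Qed.

Lemma wedge_sumr (I : finType) (g : I -> R) a (b : I -> preform) s :
  wedge a (fun s => \sum_i g i * b i s) s = \sum_i g i * wedge a (b i) s.
Proof.
under [RHS]eq_bigr do rewrite big_distrr.
rewrite exchange_big; apply: eq_bigr => m _ /=.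
by rewrite big_distrr; apply: eq_bigr => i _ /=; ring.
Qed.

Lemma wedge0l a b s : (forall s, a s = 0) -> wedge a b s = 0.
Proof. by move=> a0; apply: big1 => m _; rewrite a0 mulr0 mul0r. Qed.

Lemma wedge0r a b s : (forall s, b s = 0) -> wedge a b s = 0.
Proof. by move=> b0; apply: big1 => m _; rewrite b0 mulr0. Qed.

Lemma parity_homogeneous k a : homogeneous k a ->
  parity a =1 fun s => (-1) ^+ k * a s.
Proof.
move=> ha s; rewrite /parity; have [->//|] := eqVneq (size s) k.
by move=> /ha ->; rewrite !mulr0.
Qed.

Lemma iprod_homogeneous k a v : homogeneous k.+1 a ->
  homogeneous k (iprod v a).
Proof. by move=> ha s sk; apply: ha. Qed.

Lemma iprod_homogeneous0 a v : homogeneous 0 a ->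
  forall s, iprod v a s = 0.
Proof. by move=> ha s; apply: ha. Qed.

Lemma wedge_homogeneous p q a b : homogeneous p a -> homogeneous q b ->
  homogeneous (p + q) (wedge a b).
Proof.
move=> ha hb s spq; apply: big1 => m _.
have [e1|/ha ->] := eqVneq (size (mask m s)) p; last by rewrite mulr0 mul0r.
have [e2|/hb ->] := eqVneq (size (mask (map negb m) s)) q; last by rewrite mulr0.
move/eqP: spq; case.
rewrite -e1 -e2 !size_mask ?size_map ?size_tuple//.
rewrite count_map; apply/esym.
exact: etrans (count_predC id m) (size_tuple m).
Qed.

(* Graded commutativity of shuffles holds for arbitrary preforms, alternating
   or not; contracting both sides with a vector is what makes the induction
   work. *)
Lemma wedge_comm p q a b c s : homogeneous p a -> homogeneous q b ->
  wedge a (wedge b c) s = (-1) ^+ (p * q) * wedge b (wedge a c) s.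
Proof.
elim: s p q a b c => [|v s IH] p q a b c ha hb.
  rewrite !wedge_nil.
  case: p ha => [|p] ha; last by rewrite ha// !(mul0r, mulr0).
  by rewrite mul0n expr0; ring.
(* Leibniz rule for a triple product: its terms are again triple products, with one factor
   contracted and one argument fewer, so the induction hypothesis applies. *)
have E d d' p' q' d'' : homogeneous p' d -> homogeneous q' d' ->
    wedge d (wedge d' d'') (v :: s) = wedge (iprod v d) (wedge d' d'') s +
    (-1) ^+ p' * wedge d (wedge (iprod v d') d'') s +
    (-1) ^+ (p' + q') * wedge d (wedge d' (iprod v d'')) s.
  move=> hd hd'; rewrite wedge_cons -addrA; congr +%R.
  rewrite (wedge_ext (parity_homogeneous hd) (fun s => wedge_cons d' d'' v s)).
  rewrite wedgeZl exprD -mulrA -mulrDr; congr *%R.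
  rewrite [RHS]addrC -wedgeDZr; apply: wedge_ext => // s'.
  rewrite addrC -wedgeZl; congr +%R.
  by apply: wedge_ext => //; exact: parity_homogeneous.
rewrite (E _ _ p q)// (E _ _ q p)//.
(* In degree 0 the contraction vanishes instead of having degree [p - 1], so that case is separate.
   Otherwise lowering [p] changes the exponent [p * q] by [q], which the extra sign accounts for. *)
have -> : wedge (iprod v a) (wedge b c) s =
    (-1) ^+ (p * q) * (-1) ^+ q * wedge b (wedge (iprod v a) c) s.
  case: p ha => [|p] ha.
    rewrite wedge0l; last exact: iprod_homogeneous0.
    rewrite wedge0r ?mulr0// => s'; apply: wedge0l.
    exact: iprod_homogeneous0.
  rewrite (IH p q)//; last exact: iprod_homogeneous.
  by rewrite mulSn exprD [X in _ = X * _]mulrAC -expr2 sqrr_sign mul1r.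
have -> : wedge a (wedge (iprod v b) c) s =
    (-1) ^+ (p * q) * (-1) ^+ p * wedge (iprod v b) (wedge a c) s.
  case: q hb => [|q] hb.
    have b0 := iprod_homogeneous0 v hb.
    rewrite [in RHS](@wedge0l (iprod v b))// mulr0 wedge0r// => s'.
    exact: wedge0l.
  rewrite (IH p q)//; last exact: iprod_homogeneous.
  by rewrite mulnS exprD [X in _ = X * _]mulrAC -expr2 sqrr_sign mul1r.
rewrite (IH p q _ _ (iprod v c))// addnC.
have pp : (-1) ^+ p * (-1) ^+ p = 1 :> R by rewrite -expr2 sqrr_sign.
by ring: pp.
Qed.

Definition multilinear a := forall s1 s2 (t : R) u v,
  a (s1 ++ (t *: u + v) :: s2) = t * a (s1 ++ u :: s2) + a (s1 ++ v :: s2).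

Definition adjacent_null a := forall s1 s2 u, a (s1 ++ u :: u :: s2) = 0.

Lemma multilinear_iprod a v : multilinear a -> multilinear (iprod v a).
Proof. by move=> h s1 s2 t u u'; exact: (h (v :: s1)). Qed.

Lemma adjacent_null_iprod a v : adjacent_null a -> adjacent_null (iprod v a).
Proof. by move=> h s1 s2 u; exact: (h (v :: s1)). Qed.

(** Polarization: expand the null value of [a] on the repeated argument [u + v]. *)
Lemma multilinear_swap a u v s : multilinear a -> adjacent_null a ->
  a (u :: v :: s) = - a (v :: u :: s).
Proof.
move=> h h0; apply/eqP; rewrite -subr_eq0 opprK.
have := h0 [::] s (1 *: u + v); rewrite /= (h [::]) /=.
rewrite (h [:: u]) (h [:: v]) /= (h0 [::]) (h0 [::]) => /eqP.
by rewrite !mul1r add0r addr0.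
Qed.

Lemma multilinear_move a p x s : multilinear a -> adjacent_null a ->
  a (p ++ x :: s) = (-1) ^+ size p * a (x :: p ++ s).
Proof.
elim: p a => [|y p IH] a h h0 /=; first by rewrite expr0 mul1r.
rewrite exprS mulN1r mulNr -mulrN -multilinear_swap//.
apply: (IH (iprod y a));
  [exact: multilinear_iprod|exact: adjacent_null_iprod].
Qed.

(** Repetitions at a distance reduce to adjacent ones: the second copy is moved next to the first at
    the cost of a sign. Adjacent repetitions are what inductions on the argument list can handle. *)
Lemma alternatingP a : alternating_form a <-> multilinear a /\ adjacent_null a.
Proof.
split=> [[h1 h2]|[h1 h2]]; split => //; first by move=> s1 s2; exact: (h2 s1 [::]).
move=> s1; elim: s1 a h1 h2 => [|y s1 IH] a h1 h2 s2 s3 u /=; last first.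
  by apply: (IH (iprod y a));
    [exact: multilinear_iprod|exact: adjacent_null_iprod].
rewrite -[LHS]/(iprod u a (s2 ++ u :: s3)) multilinear_move.
- by rewrite /iprod (h2 [::]) mulr0.
- exact: multilinear_iprod.
- exact: adjacent_null_iprod.
Qed.

Lemma alternating_iprod a v :
  alternating_form a -> alternating_form (iprod v a).
Proof.
rewrite !alternatingP => -[? ?]; split;
  [exact: multilinear_iprod|exact: adjacent_null_iprod].
Qed.

Lemma alternating_move a p x s : alternating_form a ->
  a (p ++ x :: s) = (-1) ^+ size p * a (x :: p ++ s).
Proof. by rewrite alternatingP => -[? ?]; exact: multilinear_move. Qed.

(** The sign exponent is chosen before [a]: for a family of forms depending on a point it gives one
    constant sign, which does not affect smoothness. *)
Lemma perm_alternating (T : eqType) (g : T -> 'rV[R]_n) (t1 t2 : seq T) :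
  perm_eq t1 t2 -> exists k : nat, forall a, alternating_form a ->
    a (map g t1) = (-1) ^+ k * a (map g t2).
Proof.
elim: t1 t2 => [|x t1 IH] t2 p12.
  by move: p12; rewrite perm_sym => /perm_nilP ->; exists 0%N => a _; rewrite mul1r.
have : x \in t2 by rewrite -(perm_mem p12) mem_head.
move=> /path.splitPr tE; case: tE p12 => p1 p2.
rewrite perm_sym perm_catC /= perm_cons perm_catC perm_sym => /IH[k hk].
exists (k + size p1)%N => a ha; rewrite map_cat /= alternating_move// size_map.
rewrite -[LHS]/(iprod (g x) a (map g t1)) hk; last exact: alternating_iprod.
by rewrite map_cat exprD -mulrA [X in _ = _ * X]mulrA -expr2 sqrr_sign mul1r.
Qed.

(** Multilinear extension of an arbitrary array of coefficients. It expands a given form over basis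
    vectors ([mlextE]) and later also builds a form out of separately obtained coefficient
    functions. *)
Fixpoint mlext (P : seq 'I_n -> R) s : R :=
  match s with
  | [::] => P [::]
  | v :: s' => \sum_i v 0 i * mlext (fun t => P (i :: t)) s'
  end.

Lemma mlextE a s : multilinear a ->
  a s = mlext (fun t => a (map basis_vector t)) s.
Proof.
elim: s a => [//|v s IH] a h /=.
transitivity (\sum_i v 0 i * a (basis_vector i :: s)); last first.
  apply: eq_bigr => i _; congr *%R; apply: (IH (iprod (basis_vector i) a)).
  exact: multilinear_iprod.
(* Linearity at zero vectors with scalar -1: the value x satisfies x = -x + x. *)
have a0 : a (0 :: s) = 0.
  have := h [::] s (-1) 0 0; rewrite /= scaler0 addr0 => E.
  by move: E; rewrite mulN1r addNr.
have lin (J : Type) (r : seq J) (g : J -> R) (e : J -> 'rV[R]_n) :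
    a (\sum_(j <- r) g j *: e j :: s) = \sum_(j <- r) g j * a (e j :: s).
  by elim: r => [|j r IHr]; rewrite ?big_nil// !big_cons (h [::]) /= IHr.
by rewrite [in LHS](row_sum_delta v) lin.
Qed.

Lemma eq_mlext (P Q : seq 'I_n -> R) s :
  (forall t, size t = size s -> P t = Q t) -> mlext P s = mlext Q s.
Proof.
elim: s P Q => [|v s IH] P Q PQ /=; first exact: PQ.
by apply: eq_bigr => i _; congr *%R; apply: IH => t ts; apply: PQ; rewrite /= ts.
Qed.

Lemma mlextZ (k : R) P s : mlext (fun t => k * P t) s = k * mlext P s.
Proof.
elim: s P => [//|v s IH] P /=; rewrite big_distrr; apply: eq_bigr => i _ /=.
by rewrite (IH (fun t => P (i :: t))); ring.
Qed.

Lemma mlext0 P s : (forall t, size t = size s -> P t = 0) -> mlext P s = 0.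
Proof.
move=> P0; rewrite (eq_mlext (Q := fun t => 0 * P t)) ?mlextZ ?mul0r//.
by move=> t /P0 ->; rewrite mul0r.
Qed.

Lemma mlext_basis P (t : seq 'I_n) : mlext P (map basis_vector t) = P t.
Proof.
elim: t P => [//|i t IH] P /=; rewrite (bigD1 i)//= big1 ?addr0.
  by rewrite mxE !eqxx mul1r (IH (fun t => P (i :: t))).
by move=> j ji; rewrite mxE eqxx (negbTE ji) mul0r.
Qed.

Lemma alternating_not_uniq a (t : seq 'I_n) : alternating_form a -> ~~ uniq t ->
  a (map basis_vector t) = 0.
Proof.
elim: t a => [//|i t IH] a ha /=; rewrite negb_and negbK => /orP[|tu]; last first.
  by apply: (IH (iprod _ a)) => //; exact: alternating_iprod.
by case/path.splitPr => t1 t2; rewrite map_cat; case: ha => _ /(_ [::]); exact.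
Qed.

(** Pigeonhole: a sequence of more than [n] basis indices repeats one. *)
Lemma alternating_degree a s : alternating_form a -> (n < size s)%N -> a s = 0.
Proof.
move=> ha ns; rewrite mlextE; last by case: ha.
apply: mlext0 => t ts; apply: alternating_not_uniq => //.
apply/negP => /card_uniqP tE; move: ns; rewrite -ts -tE ltnNge.
by rewrite (leq_trans (max_card _))// card_ord.
Qed.

Lemma wedge_multilinear a b : multilinear a -> multilinear b ->
  multilinear (wedge a b).
Proof.
have par c : multilinear c -> multilinear (parity c).
  move=> h s1 s2 t u v; rewrite /parity h !size_cat /=; ring.
move=> ha hb s1; elim: s1 a b ha hb => [|x s1 IH] a b ha hb s2 t u v /=.
  rewrite !wedge_cons.
  rewrite (@wedge_ext _ (fun s => t * iprod u a s + iprod v a s) _ b _ _ s2)//;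
    last by move=> s; exact: (ha [::]).
  rewrite (@wedge_ext _ (parity a) (iprod (t *: u + v) b)
    (fun s => t * iprod u b s + iprod v b s) _ _ s2)//;
    last by move=> s; exact: (hb [::]).
  by rewrite wedgeDZl wedgeDZr; ring.
rewrite !wedge_cons IH//; last exact: multilinear_iprod.
rewrite IH; [by ring|exact: par|exact: multilinear_iprod].
Qed.

(** With the two equal vectors in front, the Leibniz rule leaves two mixed terms; they cancel
    because contraction anticommutes with [parity]. *)
Lemma wedge_alternating a b : alternating_form a -> alternating_form b ->
  alternating_form (wedge a b).
Proof.
rewrite !alternatingP => -[ha ha0] [hb hb0].
split; first exact: wedge_multilinear.
have par c : adjacent_null c -> adjacent_null (parity c).
  by move=> h s1 s2 u; rewrite /parity h mulr0.
move=> s1 {ha hb}; elim: s1 a b ha0 hb0 => [|x s1 IH] a b ha hb s2 u /=; last first.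
  rewrite wedge_cons IH ?IH ?addr0//; by [exact: par|exact: adjacent_null_iprod].
rewrite !wedge_cons [X in X + _ + _]wedge0l ?add0r; last by move=> s; exact: (ha [::]).
rewrite [X in _ + (_ + X)]wedge0r ?addr0; last by move=> s; exact: (hb [::]).
rewrite (@wedge_ext (iprod u (parity a))
  (fun s => -1 * parity (iprod u a) s) _ (iprod u b) _ _ s2)//.
  by rewrite wedgeZl mulN1r subrr.
by move=> s; rewrite /iprod /parity /= exprS; ring.
Qed.

Lemma unit_form_alternating : alternating_form (@unit_form R n).
Proof.
by split=> [[|? ?] *|[|? ?] *]; rewrite /unit_form /= ?mulr0 ?addr0.
Qed.

Lemma unit_form_homogeneous : homogeneous 0 (@unit_form R n).
Proof. by case. Qed.

Lemma wedge_power_alternating w p : alternating_form w ->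
  alternating_form (wedge_power w p).
Proof.
move=> hw; elim: p => [|p IH]; first exact: unit_form_alternating.
exact: wedge_alternating.
Qed.

Lemma wedge_power_homogeneous w p : homogeneous 2 w ->
  homogeneous p.*2 (wedge_power w p).
Proof.
move=> hw; elim: p => [|p IH]; first exact: unit_form_homogeneous.
by rewrite doubleS -addn2 addnC; exact: wedge_homogeneous.
Qed.

(** Contraction is a derivation on powers of the even form [w]: moving the 1-form i_v w past [w]
    costs the sign (-1)^2. Powers are nested to the right, the shape in which [wedge_comm] exchanges
    two factors. *)
Lemma iprod_wedge_power w p v s : homogeneous 2 w ->
  iprod v (wedge_power w p.+1) s =
  p.+1%:R * wedge (iprod v w) (wedge_power w p) s.
Proof.
move=> hw; elim: p s => [|p IH] s.
  by rewrite mul1r [LHS]wedge_cons [X in _ + X]wedge0r ?addr0.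
rewrite [LHS]wedge_cons.
rewrite (wedge_ext (parity_homogeneous hw) IH) wedgeZl wedgeZr.
rewrite (@wedge_comm 2 1 w)//; last exact: iprod_homogeneous.
by rewrite -[wedge w (wedge_power w p)]/(wedge_power w p.+1) -[p.+2]add1n natrD; ring.
Qed.

Lemma exp_neg_alternating w : alternating_form w -> alternating_form (exp_neg w).
Proof.
move=> hw; have hp p := wedge_power_alternating p hw; split.
  move=> s1 s2 t u v; rewrite big_distrr -big_split; apply: eq_bigr => p _ /=.
  by case: (hp p) => -> _; ring.
by move=> s1 s2 s3 u; apply: big1 => p _; case: (hp p) => _ ->; rewrite mulr0.
Qed.

Lemma exp_neg_nil w : homogeneous 2 w -> exp_neg w [::] = 1.
Proof.
move=> hw; rewrite /exp_neg big_ord_recl big1 ?addr0.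
  by rewrite expr0 fact0 invr1 mulr1 mul1r.
by move=> i _; rewrite lift0 [wedge_power _ _ _]wedge_nil hw// mul0r mulr0.
Qed.

(** This is i_v e^{-w} = -(i_v w) /\ e^{-w}. Lowering the power by one shifts the sum, so the
    truncation at [n] leaves one extra term on the right, which has to vanish. *)
Lemma exp_neg_cons w v s : alternating_form w -> homogeneous 2 w ->
  exp_neg w (v :: s) = - wedge (iprod v w) (exp_neg w) s.
Proof.
move=> aw hw; rewrite /exp_neg (wedge_sumr (fun p : 'I_n.+1 => (-1) ^+ p / p`!%:R)
  _ (fun p => wedge_power w p)).
rewrite big_ord_recl [X in X + _]mulr0 add0r big_ord_recr.
(* Up to the factor n+1 this is i_v w^(n+1), and w^(n+1) = 0: on more than [n] arguments because it
   is alternating, on at most [n] because its degree 2(n+1) is larger. *)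
have -> : wedge (iprod v w) (wedge_power w n) s = 0.
  have : iprod v (wedge_power w n.+1) s = 0.
    have [ns|sn] := ltnP n (size (v :: s)).
      apply: (@alternating_degree (wedge_power w n.+1) (v :: s)) => //.
      exact: wedge_power_alternating.
    apply: (wedge_power_homogeneous (p := n.+1)) => //.
    rewrite neq_ltn; apply/orP; left.
    by rewrite (leq_ltn_trans sn)// -addnn leq_addr.
  rewrite iprod_wedge_power// => /eqP.
  by rewrite mulf_eq0 pnatr_eq0 /= => /eqP.
rewrite mulr0 [X in _ = - X]addr0 -sumrN; apply: eq_bigr => i _.
rewrite lift0 -[wedge_power w _ _]/(iprod v (wedge_power w i.+1) s).
rewrite iprod_wedge_power// exprS factS natrM invfM /=.
have : (i.+1%:R : R) != 0 by rewrite pnatr_eq0.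
have : (i`!%:R : R) != 0 by rewrite pnatr_eq0 -lt0n fact_gt0.
move: (wedge _ _ _) (_%:R) (_%:R) (_ ^+ i) => x y z e z0 y0.
by field; rewrite z0 y0.
Qed.

(** The product beta /\ b with a covector, unrolled by the Leibniz rule so that no shuffle appears;
    [wedge1E] links it to [wedge]. *)
Fixpoint ext (beta : 'rV[R]_n -> R) b s : R :=
  match s with
  | [::] => 0
  | v :: s' => beta v * b s' - ext beta (iprod v b) s'
  end.

Lemma wedge0_homogeneous a b s : homogeneous 0 a -> wedge a b s = a [::] * b s.
Proof.
elim: s a b => [|v s IH] a b ha; first by rewrite wedge_nil.
rewrite wedge_cons wedge0l ?add0r; last exact: iprod_homogeneous0.
rewrite (wedge_ext (parity_homogeneous ha) (fun=> erefl)) wedgeZl mul1r.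
by rewrite IH.
Qed.

Lemma wedge1E a b s : homogeneous 1 a -> wedge a b s = ext (fun v => a [:: v]) b s.
Proof.
elim: s a b => [|v s IH] a b ha; first by rewrite wedge_nil ha// mul0r.
rewrite wedge_cons wedge0_homogeneous; last exact: iprod_homogeneous.
rewrite (wedge_ext (parity_homogeneous ha) (fun=> erefl)) wedgeZl expr1 mulN1r.
by rewrite IH.
Qed.

Lemma eq_ext (beta gamma : 'rV[R]_n -> R) b s : beta =1 gamma ->
  ext beta b s = ext gamma b s.
Proof. by move=> bg; elim: s b => [//|v s IH] b /=; rewrite bg IH. Qed.

Lemma ext0 (beta : 'rV[R]_n -> R) b s : (forall v, v \in s -> beta v = 0) ->
  ext beta b s = 0.
Proof.
elim: s b => [//|v s IH] b h /=; rewrite h ?mem_head// mul0r IH ?subr0//.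
by move=> u us; rewrite h// inE us orbT.
Qed.

(** The Clifford action of X + alpha on forms, i_X b + alpha /\ b. *)
Definition clifford (u : @gfiber R n) b : preform := fun s =>
  b (u.1 :: s) + ext (fun v => pairing v u.2) b s.

Definition in_graph w (u : @gfiber R n) : Prop :=
  forall v, pairing v u.2 = w [:: u.1; v].

(** The two terms are -(i_X w) /\ e^{-w} and alpha /\ e^{-w}, and alpha = i_X w on the graph; this
    is where the sign in the exponent matters. *)
Lemma clifford_exp_neg w (u : @gfiber R n) s : alternating_form w -> homogeneous 2 w ->
  in_graph w u -> clifford u (exp_neg w) s = 0.
Proof.
move=> aw hw gu; rewrite /clifford exp_neg_cons//.
rewrite wedge1E; last exact: iprod_homogeneous.
by rewrite (eq_ext _ _ gu) addNr.
Qed.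

Definition pullback (J : 'M[R]_n) a : preform := fun s => a [seq v *m J | v <- s].

Lemma pullback_wedge J a b s :
  pullback J (wedge a b) s = wedge (pullback J a) (pullback J b) s.
Proof.
rewrite /pullback (@wedgeE (size s)) ?size_map//; apply: eq_bigr => m _.
by rewrite !map_mask.
Qed.

Lemma pullback_exp_neg J w s : pullback J (exp_neg w) s = exp_neg (pullback J w) s.
Proof.
apply: eq_bigr => p _; congr *%R.
rewrite -[LHS]/(pullback J (wedge_power w p) s).
elim: (nat_of_ord p) s => {p}[|p IH] s.
  by rewrite /pullback /wedge_power /= /unit_form; case: s.
by rewrite pullback_wedge; apply: wedge_ext.
Qed.

Lemma pullback_alternating J a : alternating_form a -> alternating_form (pullback J a).
Proof.
move=> [h h0]; split.
  by move=> s1 s2 t u v; rewrite /pullback !map_cat /= mulmxDl -scalemxAl h.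
by move=> s1 s2 s3 u; rewrite /pullback map_cat /= map_cat /= h0.
Qed.

Lemma pullback_homogeneous J k a : homogeneous k a -> homogeneous k (pullback J a).
Proof. by move=> h s sk; apply: h; rewrite size_map. Qed.

End ShuffleAlgebra.

(** * Calculus of smooth maps *)

Section SmoothCalculus.
Context {R : realType}.

(** Differentiability is local. Since [Ck_on] speaks of total functions, replacing a function by a
    formula valid only on an open set rests on this, through [Ck_on_eq]. *)
Lemma near_eq_differentiable (V W : normedModType R) (f g : V -> W) x :
  {near x, f =1 g} -> differentiable f x -> differentiable g x.
Proof.
move=> fg /diff_locallyP[df fE].
have gx : g x = f x by rewrite (nbhs_singleton fg).
have gE : g \o shift x = cst (g x) + 'd f x +o_ 0 id.
  apply/eqaddoP => e e0; have /eqaddoP/(_ e e0) := fE.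
  have : \forall h \near (0 : V), f (h + x) = g (h + x).
    by have := fg; rewrite (near_shift 0) /= subr0; apply: filterS => h /=.
  by apply: filterS2 => h /= fgh; rewrite !fctE /= fgh gx.
by apply/diff_locallyP; rewrite (diff_unique df gE).
Qed.

Section Ck.
Context {V : normedModType R}.
Implicit Types (W : normedModType R) (U : set V) (k : nat).

Lemma Ck_on_eq W k U (f g : V -> W) : open U -> {in U, f =1 g} ->
  Ck_on k U f -> Ck_on k U g.
Proof.
move=> oU; elim: k f g => [|k IH] f g fg.
  move=> cf x Ux; have nfg : \near x, f x = g x.
    have := open_nbhs_nbhs (conj oU Ux); apply: filterS => y Uy.
    by apply: fg; rewrite inE.
  rewrite /prop_for /continuous_at -(nbhs_singleton nfg).
  apply: cvg_trans (cf x Ux); apply: near_eq_cvg.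
  by apply: filterS nfg => y.
have nfg x : U x -> \near x, f x = g x.
  move=> Ux; have := open_nbhs_nbhs (conj oU Ux); apply: filterS => y Uy.
  by apply: fg; rewrite inE.
move=> [df cf]; split=> [x Ux|v].
  exact: near_eq_differentiable (nfg x Ux) (df x Ux).
apply: IH (cf v) => x; rewrite inE => Ux.
exact: near_eq_derive (nfg x Ux).
Qed.

Lemma Ck_on_sub W k U U' (f : V -> W) : U' `<=` U -> Ck_on k U f -> Ck_on k U' f.
Proof.
move=> UU'; elim: k f => [|k IH] f /=; first by move=> h x /UU'; exact: h.
by case=> df cf; split=> [x /UU'|v]; [exact: df|exact: IH].
Qed.

Lemma Ck_onS W k U (f : V -> W) : Ck_on k.+1 U f -> Ck_on k U f.
Proof.
elim: k f => [|k IH] f [df cf].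
  by move=> x Ux; apply: differentiable_continuous; exact: df.
by split=> // v; apply: IH; exact: cf.
Qed.

Lemma Ck_on_cst W k U (a : W) : Ck_on k U (fun=> a).
Proof.
elim: k a => [|k IH] a; first by move=> x _; exact: cst_continuous.
split=> [x _|v]; first exact: differentiable_cst.
have -> : (fun x => 'D_v (fun=> a) x) = fun=> (0 : W).
  by apply/funext => x; exact: derive_cst.
exact: IH.
Qed.

Lemma Ck_on_linear W W' k U (L : {linear W -> W'}) (f : V -> W) :
  continuous L -> open U -> Ck_on k U f -> Ck_on k U (L \o f).
Proof.
move=> cL oU; elim: k f => [|k IH] f.
  by move=> cf x Ux; apply: continuous_comp; [exact: cf|exact: cL].
move=> [df cf]; split=> [x Ux|v].
  by apply: differentiable_comp; [exact: df|exact: linear_differentiable].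
apply: Ck_on_eq (IH _ (cf v)) => // x; rewrite inE => Ux /=.
rewrite [RHS]deriveE; last first.
  by apply: differentiable_comp; [exact: df|exact: linear_differentiable].
rewrite diff_comp; [|exact: df|exact: linear_differentiable].
by rewrite /= diff_lin// deriveE//; exact: df.
Qed.

Lemma Ck_onD W k U (f g : V -> W) : open U -> Ck_on k U f -> Ck_on k U g ->
  Ck_on k U (fun x => f x + g x).
Proof.
move=> oU; elim: k f g => [|k IH] f g.
  by move=> cf cg x Ux; apply: continuousD; [exact: cf|exact: cg].
move=> [df cf] [dg cg]; split=> [x Ux|v].
  by apply: differentiableD; [exact: df|exact: dg].
apply: Ck_on_eq (IH _ _ (cf v) (cg v)) => // x; rewrite inE => Ux /=.
by rewrite [RHS]deriveD//; apply: diff_derivable; [exact: df|exact: dg].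
Qed.

Lemma Ck_onM k U (f g : V -> R) : open U -> Ck_on k U f -> Ck_on k U g ->
  Ck_on k U (fun x => f x * g x).
Proof.
move=> oU; elim: k f g => [|k IH] f g.
  by move=> cf cg x Ux; apply: continuousM; [exact: cf|exact: cg].
move=> Cf Cg; have [df cf] := Cf; have [dg cg] := Cg; split=> [x Ux|v].
  by apply: differentiableM; [exact: df|exact: dg].
apply: (@Ck_on_eq _ _ _ (fun x => f x * 'D_v g x + g x * 'D_v f x)) => //.
  move=> x; rewrite inE => Ux /=.
  by rewrite [RHS]deriveM//; apply: diff_derivable; [exact: df|exact: dg].
apply: Ck_onD => //; apply: IH => //; by [exact: Ck_onS Cf|exact: Ck_onS Cg|exact: cf|exact: cg].
Qed.

Lemma Ck_onV k U (f : V -> R) : open U -> (forall x, U x -> f x != 0) ->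
  Ck_on k U f -> Ck_on k U (fun x => (f x)^-1).
Proof.
move=> oU f0; elim: k => [|k IH].
  by move=> cf x Ux; apply: continuousV; [exact: f0|exact: cf].
move=> Cf; have [df cf] := Cf; split=> [x Ux|v].
  by apply: differentiableV; [exact: df|exact: f0].
apply: (@Ck_on_eq _ _ _ (fun x => -1 * ((f x)^-1 * (f x)^-1 * 'D_v f x))) => //.
  move=> x; rewrite inE => Ux /=.
  rewrite [RHS]deriveV; [|exact: f0|by apply: diff_derivable; exact: df].
  by rewrite -exprVn expr2 mulN1r scaleNr.
have IHf := IH (Ck_onS Cf).
apply: Ck_onM => //; first exact: Ck_on_cst.
by apply: Ck_onM (cf v) => //; exact: Ck_onM.
Qed.

Lemma Ck_on_sum (I : Type) (r : seq I) W k U (f : I -> V -> W) : open U ->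
  (forall i, Ck_on k U (f i)) -> Ck_on k U (fun x => \sum_(i <- r) f i x).
Proof.
move=> oU h; elim: r => [|i r IH].
  apply: Ck_on_eq (Ck_on_cst k U 0) => // x _; by rewrite big_nil.
apply: Ck_on_eq (Ck_onD oU (h i) IH) => // x _; by rewrite big_cons.
Qed.

End Ck.

Lemma mxcoord_linear m p (i : 'I_m) (j : 'I_p) :
  linear (fun u : 'M[R]_(m, p) => u i j : R).
Proof. by move=> t u v; rewrite !mxE. Qed.

Lemma diff_rV m (W : normedModType R) (g : 'rV[R]_m -> W) x v :
  differentiable g x -> 'D_v g x = \sum_(i < m) v 0 i *: 'D_(basis_vector i) g x.
Proof.
move=> dg; rewrite deriveE// {1}(row_sum_delta v) linear_sum.
by apply: eq_bigr => i _; rewrite linearZ deriveE.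
Qed.

Lemma Ck_on_coord (V : normedModType R) m p k (U : set V) (f : V -> 'M[R]_(m, p)) i j :
  open U -> Ck_on k U f -> Ck_on k U (fun x => f x i j).
Proof.
move=> oU Cf.
pose L : {linear 'M[R]_(m, p) -> R} :=
  HB.pack (fun u : 'M[R]_(m, p) => u i j : R)
    (GRing.isLinear.Build R 'M[R]_(m, p) R _ _ (mxcoord_linear i j)).
by apply: (Ck_on_linear (L := L)) => //; exact: coord_continuous.
Qed.

Lemma Ck_on_comp (V : normedModType R) m k (U : set V) (U' : set 'rV[R]_m)
    (f : V -> 'rV[R]_m) (g : 'rV[R]_m -> R) : open U -> open U' ->
  (forall x, U x -> U' (f x)) -> Ck_on k U f -> Ck_on k U' g ->
  Ck_on k U (g \o f).
Proof.
move=> oU oU' UU'; elim: k g => [|k IH] g.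
  by move=> cf cg x Ux; apply: continuous_comp; [exact: cf|exact/cg/UU'].
move=> Cf [dg cg]; have [df cf] := Cf; split=> [x Ux|v].
  by apply: differentiable_comp; [exact: df|exact/dg/UU'].
(* Chain rule in coordinates; the induction hypothesis covers the composites with the partial
   derivatives of [g]. *)
apply: (@Ck_on_eq _ _ _ _
  (fun x => \sum_(i < m) 'D_v f x 0 i * ('D_(basis_vector i) g \o f) x)) => //.
  move=> x; rewrite inE => Ux /=.
  have dfx := df _ Ux; have dgx := dg _ (UU' _ Ux).
  rewrite [RHS]deriveE; last exact: differentiable_comp.
  by rewrite diff_comp//= -(deriveE v dfx) -(deriveE _ dgx) diff_rV.
apply: Ck_on_sum => // i; apply: Ck_onM => //; first exact: Ck_on_coord (cf v).
by apply: IH; [exact: Ck_onS Cf|exact: cg].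
Qed.

Section Smooth.
Context {V : normedModType R}.
Implicit Types (W : normedModType R) (U : set V).

Lemma smooth_on_eq W U (f g : V -> W) : open U -> {in U, f =1 g} ->
  smooth_on U f -> smooth_on U g.
Proof. by move=> oU fg h k; exact: Ck_on_eq (h k). Qed.

Lemma smooth_on_sub W U U' (f : V -> W) : U' `<=` U ->
  smooth_on U f -> smooth_on U' f.
Proof. by move=> UU' h k; exact: Ck_on_sub (h k). Qed.

Lemma smooth_on_differentiable W U (f : V -> W) x : smooth_on U f -> U x ->
  differentiable f x.
Proof. by move=> /(_ 1%N) [h _]; exact: h. Qed.

Lemma smooth_on_continuous W U (f : V -> W) x : smooth_on U f -> U x ->
  {for x, continuous f}.
Proof. by move=> /(_ 0%N); exact. Qed.

Lemma smooth_on_derive W U (f : V -> W) v : smooth_on U f ->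
  smooth_on U (fun x => 'D_v f x).
Proof. by move=> h k; case: (h k.+1) => _; exact. Qed.

Lemma smooth_on_cst W U (a : W) : smooth_on U (fun=> a).
Proof. by move=> k; exact: Ck_on_cst. Qed.

Lemma smooth_on_id U : smooth_on U (fun y : V => y).
Proof.
case=> [|k]; first by move=> x _.
split=> [x _|v]; first exact: ex_diff.
have -> : (fun y : V => 'D_v (fun z : V => z) y) = fun=> v.
  by apply/funext => y; exact: derive_id.
exact: Ck_on_cst.
Qed.

Lemma smooth_on_linear W W' U (L : {linear W -> W'}) (f : V -> W) :
  continuous L -> open U -> smooth_on U f -> smooth_on U (L \o f).
Proof. by move=> cL oU h k; exact: Ck_on_linear. Qed.

Lemma smooth_onD W U (f g : V -> W) : open U -> smooth_on U f -> smooth_on U g ->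
  smooth_on U (fun x => f x + g x).
Proof. by move=> oU hf hg k; exact: Ck_onD. Qed.

Lemma smooth_onM U (f g : V -> R) : open U -> smooth_on U f -> smooth_on U g ->
  smooth_on U (fun x => f x * g x).
Proof. by move=> oU hf hg k; exact: Ck_onM. Qed.

Lemma smooth_onN U (f : V -> R) : open U -> smooth_on U f ->
  smooth_on U (fun x => - f x).
Proof.
move=> oU hf; apply: smooth_on_eq (smooth_onM oU (smooth_on_cst U (-1 : R)) hf) => //.
by move=> x _; rewrite mulN1r.
Qed.

Lemma smooth_onV U (f : V -> R) : open U -> (forall x, U x -> f x != 0) ->
  smooth_on U f -> smooth_on U (fun x => (f x)^-1).
Proof. by move=> oU f0 hf k; exact: Ck_onV. Qed.

Lemma smooth_on_sum (I : Type) (r : seq I) W U (f : I -> V -> W) : open U ->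
  (forall i, smooth_on U (f i)) -> smooth_on U (fun x => \sum_(i <- r) f i x).
Proof. by move=> oU h k; apply: Ck_on_sum => // i; exact: h. Qed.

Lemma smooth_on_prod (I : Type) (r : seq I) U (f : I -> V -> R) : open U ->
  (forall i, smooth_on U (f i)) -> smooth_on U (fun x => \prod_(i <- r) f i x).
Proof.
move=> oU h; elim: r => [|i r IH].
  by apply: smooth_on_eq (smooth_on_cst U (1 : R)) => // x _; rewrite big_nil.
by apply: smooth_on_eq (smooth_onM oU (h i) IH) => // x _; rewrite big_cons.
Qed.

Lemma smooth_on_coord m p U (f : V -> 'M[R]_(m, p)) i j :
  open U -> smooth_on U f -> smooth_on U (fun x => f x i j).
Proof. by move=> oU h k; exact: Ck_on_coord. Qed.

Lemma smooth_on_comp m U (U' : set 'rV[R]_m) (f : V -> 'rV[R]_m)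
    (g : 'rV[R]_m -> R) : open U -> open U' ->
  (forall x, U x -> U' (f x)) -> smooth_on U f -> smooth_on U' g ->
  smooth_on U (g \o f).
Proof. by move=> oU oU' UU' hf hg k; exact: Ck_on_comp (hf k) (hg k). Qed.

Lemma smooth_on_scale W U (f : V -> R) (b : W) : open U -> smooth_on U f ->
  smooth_on U (fun x => f x *: b).
Proof.
move=> oU hf.
have lin : linear (fun r : R => r *: b).
  by move=> t u v; rewrite scalerDl scalerA.
pose L : {linear R -> W} :=
  HB.pack (fun r : R => r *: b) (GRing.isLinear.Build R R W _ _ lin).
by apply: (smooth_on_linear (L := L)) => //; exact: scalel_continuous.
Qed.

Definition smooth_mx m p U (f : V -> 'M[R]_(m, p)) :=
  forall i j, smooth_on U (fun x => f x i j).

Lemma smooth_mxM m p q U (f : V -> 'M[R]_(m, p)) (g : V -> 'M[R]_(p, q)) :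
  open U -> smooth_mx U f -> smooth_mx U g -> smooth_mx U (fun x => f x *m g x).
Proof.
move=> oU hf hg i j.
apply: (@smooth_on_eq _ _ (fun x => \sum_k f x i k * g x k j)) => //.
  by move=> x _; rewrite mxE.
by apply: smooth_on_sum => // k; exact: smooth_onM.
Qed.

Lemma smooth_on_det m U (f : V -> 'M[R]_m) : open U -> smooth_mx U f ->
  smooth_on U (fun x => \det (f x)).
Proof.
move=> oU hf; apply: smooth_on_sum => // s.
apply: smooth_onM => //; first exact: smooth_on_cst.
by apply: smooth_on_prod.
Qed.

(** By Cramer's rule the entries are cofactors divided by the determinant. *)
Lemma smooth_mx_inv m U (f : V -> 'M[R]_m) : open U -> smooth_mx U f ->
  (forall x, U x -> f x \in unitmx) -> smooth_mx U (fun x => invmx (f x)).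
Proof.
move=> oU hf fu i j.
apply: (@smooth_on_eq _ _ (fun x => (\det (f x))^-1 * cofactor (f x) j i)) => //.
  move=> x; rewrite inE => Ux.
  by rewrite /invmx fu// !mxE.
apply: smooth_onM => //.
  apply: smooth_onV => //; last exact: smooth_on_det.
  by move=> x /fu; rewrite unitmxE unitfE.
apply: smooth_onM => //; first exact: smooth_on_cst.
apply: smooth_on_det => // k l.
by apply: smooth_on_eq (hf (lift j k) (lift i l)) => // x _; rewrite !mxE.
Qed.

End Smooth.
End SmoothCalculus.

(** * Symmetry of mixed second derivatives *)

Section Schwarz.
Context {R : realType} {V : normedModType R}.

Lemma MVT_line (g : V -> R) x u (t : R) : 0 < t ->
  (forall s, 0 <= s <= t -> differentiable g (x + s *: u)) ->
  exists2 s, 0 <= s <= t & g (x + t *: u) - g x = t * 'D_u g (x + s *: u).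
Proof.
move=> t0 dg; pose f (s : R) := g (x + s *: u).
have df s : 0 <= s <= t -> is_derive s 1 f ('D_u g (x + s *: u)).
  move=> /dg dgs.
  have dl : is_diff s (fun s : R => x + s *: u) (fun s : R => s *: u).
    have := is_diffD (is_diff_cst x s) (is_diff_scalel s u).
    by rewrite [X in is_diff _ _ X]add0r.
  have dgf : is_diff s f ('d g (x + s *: u) \o (fun s : R => s *: u)).
    exact: is_diff_comp dl (differentiableP dgs).
  apply: DeriveDef; first exact: diff_derivable.
  by rewrite deriveE// diff_val /= scale1r deriveE.
have [s sI fE] : exists2 s, s \in `[0, t] &
    f t - f 0 = 'D_u g (x + s *: u) * (t - 0).
  apply: (MVT_segment (df := fun s => 'D_u g (x + s *: u))); first exact: ltW.
    by move=> s; rewrite in_itv => /andP[/ltW s0 /ltW st]; apply: df; rewrite s0.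
  apply: derivable_within_continuous => s; rewrite in_itv => /df[].
  by [].
exists s; first by move: sI; rewrite in_itv.
by move: fE; rewrite /f scale0r addr0 subr0 mulrC.
Qed.

Lemma derive_translate (g : V -> R) u w x :
  'D_u (fun y => g (y + w)) x = 'D_u g (x + w).
Proof.
rewrite /derive.
suff -> : (fun h : R => h^-1 *: (((fun y => g (y + w)) \o shift x) (h *: u) - g (x + w)))
  = (fun h => h^-1 *: ((g \o shift (x + w)) (h *: u) - g (x + w))) by [].
by apply/funext => h /=; rewrite addrA.
Qed.

Lemma differentiable_translate (g : V -> R) w x : differentiable g (x + w) ->
  differentiable (fun y => g (y + w)) x.
Proof.
by move=> dg; apply: (@differentiable_comp _ _ _ _ (fun y => y + w) g).
Qed.

(** The mean value theorem is applied twice: along [u] to the increment of [g] by [t *: v], then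
    along [v] to the derivative of [g] along [u]. The second difference itself is symmetric in [u]
    and [v], which [derive_comm] exploits. *)
Lemma second_difference (g : V -> R) x u v (t : R) : 0 < t ->
  (forall s s', 0 <= s <= t -> 0 <= s' <= t ->
    differentiable g (x + s *: u + s' *: v) /\
    differentiable (fun y => 'D_u g y) (x + s *: u + s' *: v)) ->
  exists s s', [/\ 0 <= s <= t, 0 <= s' <= t &
    g (x + t *: u + t *: v) - g (x + t *: u) - (g (x + t *: v) - g x) =
    t * (t * 'D_v (fun y => 'D_u g y) (x + s *: u + s' *: v))].
Proof.
move=> t0 dg.
have t00 : 0 <= (0 : R) <= t by rewrite lexx ltW.
have tt0 : 0 <= t <= t by rewrite lexx ltW.
have dg0 s : 0 <= s <= t -> differentiable g (x + s *: u).
  by move=> st; have [] := dg s 0 st t00; rewrite scale0r addr0.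
pose G y := g (y + t *: v) - g y.
have [|s st] := @MVT_line G x u t t0.
  move=> s st; apply: differentiableB; last exact: dg0.
  by apply: differentiable_translate; have [] := dg s t st tt0.
rewrite /G => ->.
have [|s' st' E] := @MVT_line (fun y => 'D_u g y) (x + s *: u) v t t0.
  by move=> s' st'; have [] := dg s s' st st'.
exists s, s'; split => //; rewrite -E.
congr (t * _); rewrite [LHS]deriveB.
- by rewrite derive_translate.
- apply: diff_derivable; apply: differentiable_translate.
  by have [] := dg s t st tt0.
- by apply: diff_derivable; exact: dg0.
Qed.

(** Both mixed derivatives, each at its own point of a small parallelogram at [x], equal the same
    second difference divided by t^2; continuity at [x] then compares them at [x]. *)
Lemma derive_comm (U : set V) (g : V -> R) x u v : open U -> smooth_on U g -> U x ->
  'D_u (fun y => 'D_v g y) x = 'D_v (fun y => 'D_u g y) x.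
Proof.
move=> oU sg Ux; apply/eqP; rewrite -subr_eq0 -normr_le0; apply/ler_addgt0Pr => e e0.
rewrite add0r.
pose H1 y := 'D_u (fun y => 'D_v g y) y; pose H2 y := 'D_v (fun y => 'D_u g y) y.
have c1 : {for x, continuous H1}.
  by apply: (@smooth_on_continuous _ _ _ U) => //; do 2 apply: smooth_on_derive.
have c2 : {for x, continuous H2}.
  by apply: (@smooth_on_continuous _ _ _ U) => //; do 2 apply: smooth_on_derive.
have e2 : 0 < e / 2 by rewrite divr_gt0.
have n1 : \forall y \near x, `|H1 x - H1 y| < e / 2.
  by move/cvgrPdist_lt : c1 => /(_ _ e2).
have n2 : \forall y \near x, `|H2 x - H2 y| < e / 2.
  by move/cvgrPdist_lt : c2 => /(_ _ e2).
have n3 : \forall y \near x, U y by exact: open_nbhs_nbhs.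
have : nbhs x [set y | U y /\ `|H1 x - H1 y| < e / 2 /\ `|H2 x - H2 y| < e / 2].
  by apply: filterS2 n3 (filterI n1 n2).
move=> /nbhs_ballP[r /= r0 hr].
have uv0 : 0 < `|u| + `|v| + 1 by rewrite ltr_wpDl// addr_ge0.
(* The added 1 avoids a zero denominator and keeps the parallelogram strictly inside the ball of
   radius [r]. *)
pose t := r / (`|u| + `|v| + 1).
have t0 : 0 < t by rewrite divr_gt0.
have near s s' : 0 <= s <= t -> 0 <= s' <= t ->
    [/\ U (x + s *: u + s' *: v), `|H1 x - H1 (x + s *: u + s' *: v)| < e / 2 &
      `|H2 x - H2 (x + s *: u + s' *: v)| < e / 2].
  move=> /andP[s0 st] /andP[s0' st'].
  have [|h1 [h2 h3]//] := hr (x + s *: u + s' *: v).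
  rewrite -ball_normE /= -addrA opprD addNKr normrN.
  apply: le_lt_trans (ler_normD _ _) _; rewrite !normrZ !ger0_norm//.
  apply: (@le_lt_trans _ _ (t * `|u| + t * `|v|)).
    by apply: lerD; apply: ler_wpM2r.
  by rewrite -mulrDr /t mulrAC ltr_pdivrMr// ltr_pM2l// ltrDl.
clearbody t.
have [|s1 [s2 [i1 i2 E1]]] := @second_difference g x u v t t0.
  move=> s s' st st'; have [Uy _ _] := near s s' st st'.
  by split; apply: smooth_on_differentiable Uy => //; exact: smooth_on_derive.
have [|s3 [s4 [i3 i4 E2]]] := @second_difference g x v u t t0.
  move=> s s' st st'; have [Uy _ _] := near s' s st' st; rewrite addrAC.
  by split; apply: smooth_on_differentiable Uy => //; exact: smooth_on_derive.
have E : H2 (x + s1 *: u + s2 *: v) = H1 (x + s4 *: u + s3 *: v).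
  have tn : t * t != 0 by rewrite mulf_neq0// gt_eqF.
  have Ey : x + s4 *: u + s3 *: v = x + s3 *: v + s4 *: u by rewrite addrAC.
  have Et : x + t *: u + t *: v = x + t *: v + t *: u by rewrite addrAC.
  have {}E1 : t * t * H2 (x + s1 *: u + s2 *: v) =
      g (x + t *: u + t *: v) - g (x + t *: u) - (g (x + t *: v) - g x).
    by rewrite E1 mulrA.
  have {}E2 : t * t * H1 (x + s4 *: u + s3 *: v) =
      g (x + t *: u + t *: v) - g (x + t *: v) - (g (x + t *: u) - g x).
    by rewrite Ey Et E2 mulrA.
  clearbody H1 H2; apply: (mulfI tn); rewrite E1 E2.
  move: (g (x + t *: u + t *: v)) (g (x + t *: u)) (g (x + t *: v)) (g x).
  by move=> a b c d; ring.
have [_ _ b1] := near _ _ i1 i2; have [_ b2 _] := near _ _ i4 i3.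
rewrite -/(H1 x) -/(H2 x); clearbody H1 H2.
rewrite (_ : H1 x - H2 x =
  (H1 x - H1 (x + s4 *: u + s3 *: v)) - (H2 x - H2 (x + s1 *: u + s2 *: v))).
  by apply: le_trans (ler_normB _ _) _; rewrite [leRHS]splitr; apply: lerD; exact: ltW.
rewrite E; move: (H1 x) (H2 x) (H1 _) => a b c; by ring.
Qed.

End Schwarz.

(** * Charts and coordinates *)

Section Charts.
Context {R : realType} {n : nat} {M : topologicalType}.
Context {A : smooth_manifold R n M}.
Local Notation I := (chart_index A).
Implicit Types (i j k c : I) (x : M) (W : set M).

Lemma chart_image_open i W : open W -> open (chart i @` (W `&` chart_dom i)).
Proof.
move=> oW; rewrite openE => _ [x [Wx dx] <-].
have im : (chart i @` chart_dom i) (chart i x) by exists x.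
have n1 : \forall y \near chart i x, (chart i @` chart_dom i) y.
  exact: open_nbhs_nbhs (conj (@chart_im_open _ _ _ A i) im).
have n2 : \forall y \near chart i x, W (chart_inv i y).
  apply: (chart_inv_continuous im); rewrite chartK//.
  exact: open_nbhs_nbhs (conj oW Wx).
apply: filterS2 n1 n2 => _ [z dz <-]; rewrite chartK// => Wz.
by exists z.
Qed.

Lemma transition_smooth i j :
  smooth_on (chart i @` (chart_dom j `&` chart_dom i)) (chart j \o chart_inv i).
Proof. by rewrite setIC; exact: chart_compatible. Qed.

Lemma transition_differentiable i j x : chart_dom i x -> chart_dom j x ->
  differentiable (chart j \o chart_inv i) (chart i x).
Proof.
move=> ix jx; apply: (smooth_on_differentiable (@transition_smooth i j)).
by exists x.
Qed.

(* A sealed copy of [jac]: unification would otherwise compare jacobians by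
   unfolding the definition of the differential. *)
Fact cjac_subproof : {J : I -> I -> M -> 'M[R]_n | @jac R n M A = J}.
Proof. by exists (@jac R n M A). Qed.
Definition cjac := sval cjac_subproof.
Lemma cjacE : @jac R n M A = cjac. Proof. exact: svalP cjac_subproof. Qed.

Lemma mul_jac i j x v : chart_dom i x -> chart_dom j x ->
  v *m cjac i j x = 'D_v (chart j \o chart_inv i) (chart i x).
Proof.
move=> ix jx; rewrite -cjacE deriveEjacobian//.
exact: transition_differentiable.
Qed.

Lemma mulmx_row_eq m p (B C : 'M[R]_(m, p)) :
  (forall v : 'rV_m, v *m B = v *m C) -> B = C.
Proof. by move=> h; apply/row_matrixP => k; rewrite !rowE h. Qed.

Lemma near_chart i j x : chart_dom i x -> chart_dom j x ->
  \forall y \near chart i x, exists z,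
    [/\ chart_dom i z, chart_dom j z & y = chart i z].
Proof.
move=> ix jx.
have o : open (chart i @` (chart_dom j `&` chart_dom i)).
  by apply: chart_image_open; exact: chart_dom_open.
have : (chart i @` (chart_dom j `&` chart_dom i)) (chart i x) by exists x.
move=> /(conj o) /open_nbhs_nbhs.
by apply: filterS => _ [z [? ?] <-]; exists z.
Qed.

Lemma derive_comp (V V' V'' : normedModType R) (f : V -> V') (g : V' -> V'')
    (x : V) (y : V') v :
  differentiable f x -> f x = y -> differentiable g y ->
  'D_v (g \o f) x = 'D_('D_v f x) g y.
Proof.
move=> df <- dg.
rewrite [LHS]deriveE; last exact: differentiable_comp.
by rewrite diff_comp//= -(deriveE v df) -(deriveE _ dg).
Qed.

Lemma jac_id i x : chart_dom i x -> cjac i i x = 1%:M.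
Proof.
move=> ix; apply: mulmx_row_eq => v; rewrite mulmx1 mul_jac//.
rewrite (@near_eq_derive _ _ _ _ id); first by rewrite derive_id.
by apply: filterS (near_chart ix ix) => _ [z [? _ ->]] /=; rewrite chartK.
Qed.

Lemma jac_comp i j k x : chart_dom i x -> chart_dom j x -> chart_dom k x ->
  cjac i j x *m cjac j k x = cjac i k x.
Proof.
move=> ix jx kx; apply: mulmx_row_eq => v.
have E1 := congr1 (mulmx^~ (cjac j k x)) (mul_jac v ix jx).
have E2 := mul_jac ('D_v (chart j \o chart_inv i) (chart i x)) jx kx.
apply: (etrans (mulmxA _ _ _)); apply: (etrans E1); apply: (etrans E2).
apply: (etrans _ (esym (mul_jac v ix kx))).
rewrite [RHS](@near_eq_derive _ _ _ _
  ((chart k \o chart_inv j) \o (chart j \o chart_inv i))); last first.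
  by apply: filterS (near_chart ix jx) => _ [z [? ? ->]] /=; rewrite !chartK.
have dij := transition_differentiable ix jx.
have djk := transition_differentiable jx kx.
apply: esym; apply: derive_comp => //.
by rewrite /= chartK.
Qed.

Lemma jacK i j x : chart_dom i x -> chart_dom j x ->
  cjac i j x *m cjac j i x = 1%:M.
Proof. by move=> ix jx; rewrite jac_comp// jac_id. Qed.

Lemma jac_smooth i j W : open W -> W `<=` chart_dom j ->
  smooth_mx (chart i @` (W `&` chart_dom i)) (fun y => cjac i j (chart_inv i y)).
Proof.
move=> oW Wj k l.
apply: (@smooth_on_eq _ _ _ _
  (fun y => 'D_(basis_vector k) (chart j \o chart_inv i) y 0 l)).
- exact: chart_image_open.
- move=> y; rewrite inE => -[x [Wx ix] <-]; have jx := Wj _ Wx.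
  by rewrite chartK// -mul_jac// -rowE mxE.
- apply: smooth_on_coord; first exact: chart_image_open.
  apply: smooth_on_derive; apply: smooth_on_sub (@transition_smooth i j).
  by move=> _ [x [/Wj jx ix] <-]; exists x.
Qed.

Lemma smooth_on_transition i c W (g : 'rV[R]_n -> R) : open W ->
  W `<=` chart_dom c -> smooth_on (chart c @` (W `&` chart_dom c)) g ->
  smooth_on (chart i @` (W `&` chart_dom i)) (g \o (chart c \o chart_inv i)).
Proof.
move=> oW Wc sg.
apply: (smooth_on_comp (U' := chart c @` (W `&` chart_dom c))) => //.
- exact: chart_image_open.
- exact: chart_image_open.
- move=> _ [x [Wx ix] <-] /=; rewrite chartK//.
  by exists x => //; split => //; exact: Wc.
- apply: smooth_on_sub (@transition_smooth i c).
  by move=> _ [x [/Wc ? ?] <-]; exists x.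
Qed.

Lemma jac_inv_smooth i j W : open W -> W `<=` chart_dom j ->
  smooth_mx (chart i @` (W `&` chart_dom i)) (fun y => cjac j i (chart_inv i y)).
Proof.
move=> oW Wj k l.
have oWi : open (W `&` chart_dom i) by apply: openI => //; exact: chart_dom_open.
have : smooth_on (chart i @` ((W `&` chart_dom i) `&` chart_dom i))
    ((fun y => cjac j i (chart_inv j y) k l) \o (chart j \o chart_inv i)).
  apply: smooth_on_transition => //; first by move=> x [/Wj].
  by apply: jac_smooth => // x [].
rewrite -setIA setIid; apply: smooth_on_eq; first exact: chart_image_open.
move=> y; rewrite inE => -[x [Wx ix] <-] /=.
by rewrite !chartK//; exact: Wj.
Qed.

(** Fibres are written in the preferred chart of [x], which need not vary continuously with [x].
    Passing to a fixed chart [i] gives coordinates in which continuity and smoothness are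
    meaningful. *)
Definition tocoord i x (u : gfiber) : @gfiber R n :=
  (u.1 *m cjac (chart_at A x) i x, cjac i (chart_at A x) x *m u.2).

Definition ofcoord i x (u : gfiber) : @gfiber R n :=
  (u.1 *m cjac i (chart_at A x) x, cjac (chart_at A x) i x *m u.2).

Lemma section_coordsE i e y :
  section_coords i e y = tocoord i (chart_inv i y) (e (chart_inv i y)).
Proof. by rewrite /section_coords cjacE. Qed.

Lemma of_coordsE i p :
  of_coords i p = (chart_inv i p.1, ofcoord i (chart_inv i p.1) p.2).
Proof. by rewrite /of_coords cjacE. Qed.

Lemma tocoordK i x : chart_dom i x -> cancel (tocoord i x) (ofcoord i x).
Proof.
move=> ix [X a]; have cx := chart_at_dom A x.
rewrite /tocoord /ofcoord /=; congr pair.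
  by rewrite -mulmxA jacK// mulmx1.
by rewrite mulmxA jacK// mul1mx.
Qed.

Lemma ofcoordK i x : chart_dom i x -> cancel (ofcoord i x) (tocoord i x).
Proof.
move=> ix [X a]; have cx := chart_at_dom A x.
rewrite /tocoord /ofcoord /=; congr pair.
  by rewrite -mulmxA jacK// mulmx1.
by rewrite mulmxA jacK// mul1mx.
Qed.

Lemma tocoord_transition i j x u : chart_dom i x -> chart_dom j x ->
  tocoord j x u = ((tocoord i x u).1 *m cjac i j x, cjac j i x *m (tocoord i x u).2).
Proof.
move=> ix jx; have cx := chart_at_dom A x.
by rewrite /tocoord /= -(mulmxA u.1) (mulmxA (cjac j i x)) !jac_comp.
Qed.

Lemma pairing_tocoord i x u v : chart_dom i x ->
  pairing (tocoord i x u).1 (tocoord i x v).2 = pairing u.1 v.2.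
Proof.
move=> ix; have cx := chart_at_dom A x.
by rewrite /pairing /= mulmxA -(mulmxA u.1) jacK// mulmx1.
Qed.

Lemma isotropic_pairing_tocoord i x u v : chart_dom i x ->
  isotropic_pairing (tocoord i x u) (tocoord i x v) = isotropic_pairing u v.
Proof. by move=> ix; rewrite /isotropic_pairing !pairing_tocoord. Qed.

Lemma iso_ofcoord i x u v : chart_dom i x ->
  isotropic_pairing (ofcoord i x u) (ofcoord i x v) = isotropic_pairing u v.
Proof. by move=> ix; rewrite -(isotropic_pairing_tocoord _ _ ix) !ofcoordK. Qed.

Lemma tocoord_linear i x : linear (tocoord i x).
Proof.
move=> t u v; rewrite /tocoord; congr pair => /=.
  by rewrite mulmxDl scalemxAl.
by rewrite mulmxDr scalemxAr.
Qed.

Lemma ofcoord_linear i x : linear (ofcoord i x).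
Proof.
move=> t u v; rewrite /ofcoord; congr pair => /=.
  by rewrite mulmxDl scalemxAl.
by rewrite mulmxDr scalemxAr.
Qed.

HB.instance Definition _ i x :=
  GRing.isLinear.Build R gfiber gfiber _ (tocoord i x) (@tocoord_linear i x).
HB.instance Definition _ i x :=
  GRing.isLinear.Build R gfiber gfiber _ (ofcoord i x) (@ofcoord_linear i x).

Definition fcoord i x (a : preform) : @preform R n :=
  pullback (cjac i (chart_at A x) x) a.

Lemma form_coordsE i w y s :
  form_coords i w y s = fcoord i (chart_inv i y) (w (chart_inv i y)) s.
Proof. by rewrite /form_coords cjacE. Qed.

Lemma fcoord_transition i j x a s : chart_dom i x -> chart_dom j x ->
  fcoord j x a s = pullback (cjac j i x) (fcoord i x a) s.
Proof.
move=> ix jx; have cx := chart_at_dom A x.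
rewrite /fcoord /pullback -map_comp; congr a; apply: eq_map => v /=.
by rewrite -mulmxA jac_comp.
Qed.

Lemma fcoordK i x a s : chart_dom i x ->
  pullback (cjac (chart_at A x) i x) (fcoord i x a) s = a s.
Proof.
move=> ix; have cx := chart_at_dom A x.
rewrite /fcoord /pullback -map_comp -[RHS](congr1 a (map_id s)); congr a.
by apply: eq_map => v /=; rewrite -mulmxA jacK// mulmx1.
Qed.

Lemma fcoord_pullback i x (a : @preform R n) s : chart_dom i x ->
  fcoord i x (pullback (cjac (chart_at A x) i x) a) s = a s.
Proof.
move=> ix; have cx := chart_at_dom A x.
rewrite /fcoord /pullback -map_comp -[RHS](congr1 a (map_id s)); congr a.
by apply: eq_map => v /=; rewrite -mulmxA jacK// mulmx1.
Qed.

Lemma in_graph_coord i x a u : chart_dom i x ->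
  in_graph (fcoord i x a) (tocoord i x u) <-> in_graph a u.
Proof.
move=> ix; have cx := chart_at_dom A x; rewrite /in_graph /fcoord /pullback /=.
have E v : pairing v (cjac i (chart_at A x) x *m u.2) =
    pairing (v *m cjac i (chart_at A x) x) u.2 by rewrite /pairing mulmxA.
split=> h v.
  have := h (v *m cjac (chart_at A x) i x).
  by rewrite E /= -!mulmxA !jacK// !mulmx1.
by rewrite E h /= -!mulmxA !jacK// !mulmx1.
Qed.

Lemma smooth_mlext (V : normedModType R) (U : set V) (T : Type)
    (P : V -> seq 'I_n -> R) (g : V -> T -> 'rV[R]_n) (s : seq T) : open U ->
  (forall t, smooth_on U (fun y => P y t)) -> (forall v, smooth_mx U (g ^~ v)) ->
  smooth_on U (fun y => mlext (P y) (map (g y) s)).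
Proof.
move=> oU + sg; elim: s P => [|v s IH] P sP /=; first exact: sP.
apply: smooth_on_sum => // k; apply: smooth_onM => //; first exact: sg.
by apply: (IH (fun y t => P y (k :: t))).
Qed.

Lemma smooth_mx_mull (V : normedModType R) (U : set V) p q r (v : 'M[R]_(p, q))
    (g : V -> 'M[R]_(q, r)) :
  open U -> smooth_mx U g -> smooth_mx U (fun y => v *m g y).
Proof.
by move=> oU sg; apply: smooth_mxM => // k l; exact: smooth_on_cst.
Qed.

(** One chart containing [W] and basis vectors as arguments suffice: another chart differs by a
    smooth transition map and by smooth Jacobians applied to the arguments, and multilinearity
    expands the result in the given coefficients. *)
Lemma differential_form_chart c W w : open W -> W `<=` chart_dom c ->
  (forall x, W x -> alternating_form (w x)) ->
  (forall t, smooth_on (chart c @` (W `&` chart_dom c))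
     (fun y => fcoord c (chart_inv c y) (w (chart_inv c y)) (map basis_vector t))) ->
  differential_form A W w.
Proof.
move=> oW Wc aw sw; split=> // i s.
pose P y t := fcoord c (chart_inv c y) (w (chart_inv c y)) (map basis_vector t).
have oi : open (chart i @` (W `&` chart_dom i)) by exact: chart_image_open.
apply: (@smooth_on_eq _ _ _ _ (fun y => mlext (P ((chart c \o chart_inv i) y))
  [seq v *m cjac i c (chart_inv i y) | v <- s])).
- exact: oi.
- move=> y; rewrite inE => -[x [Wx ix] <-] /=; have cx := Wc _ Wx.
  rewrite form_coordsE !chartK// (fcoord_transition _ _ cx ix) /pullback.
  rewrite [RHS]mlextE; last first.
    by case: (pullback_alternating (cjac c (chart_at A x) x) (aw _ Wx)).
  by apply: eq_mlext => t _; rewrite /P !chartK.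
apply: (@smooth_mlext _ _ _ (P \o (chart c \o chart_inv i))
  (fun y v => v *m cjac i c (chart_inv i y))).
- exact: oi.
- move=> t; exact: (@smooth_on_transition i c W (P ^~ t) oW Wc (sw t)).
- move=> v; apply: smooth_mx_mull; [exact: oi|exact: jac_smooth].
Qed.

Lemma smooth_function_chart c W f : open W -> W `<=` chart_dom c ->
  smooth_on (chart c @` (W `&` chart_dom c)) (f \o chart_inv c) ->
  smooth_function A W f.
Proof.
move=> oW Wc sf i; apply: (@smooth_on_eq _ _ _ _
  ((f \o chart_inv c) \o (chart c \o chart_inv i))).
- exact: chart_image_open.
- by move=> y; rewrite inE => -[x [Wx ix] <-] /=; rewrite !chartK//; exact: Wc.
- exact: smooth_on_transition.
Qed.

Lemma smooth_on_gfiber (V : normedModType R) (U : set V) (g : V -> @gfiber R n) :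
  open U -> smooth_mx U (fun y => (g y).1) -> smooth_mx U (fun y => (g y).2) ->
  smooth_on U g.
Proof.
move=> oU s1 s2.
apply: (@smooth_on_eq _ _ _ _ (fun y =>
  \sum_k (g y).1 0 k *: ((delta_mx 0 k, 0) : @gfiber R n) +
  \sum_k (g y).2 k 0 *: ((0, delta_mx k 0) : @gfiber R n))) => //.
  move=> y _; case: (g y) => X a /=.
  have E1 : \sum_k X 0 k *: ((delta_mx 0 k, 0) : @gfiber R n) = (X, 0).
    apply: injective_projections.
      by rewrite (raddf_sum (fst : {linear gfiber -> 'rV[R]_n})) /= -row_sum_delta.
    rewrite (raddf_sum (snd : {linear gfiber -> 'cV[R]_n})) big1// => k _.
    exact: scaler0.
  have E2 : \sum_k a k 0 *: ((0, delta_mx k 0) : @gfiber R n) = (0, a).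
    apply: injective_projections.
      rewrite (raddf_sum (fst : {linear gfiber -> 'rV[R]_n})) big1// => k _.
      exact: scaler0.
    rewrite (raddf_sum (snd : {linear gfiber -> 'cV[R]_n})) /=.
    rewrite [RHS]matrix_sum_delta; apply: eq_bigr => k _.
    by rewrite big_ord1.
  by rewrite E1 E2; congr pair; rewrite ?addr0 ?add0r.
by apply: smooth_onD => //; apply: smooth_on_sum => // k; apply: smooth_on_scale.
Qed.

Lemma smooth_on_fst (V : normedModType R) (U : set V) (g : V -> @gfiber R n) :
  open U -> smooth_on U g -> smooth_on U (fun y => (g y).1).
Proof.
move=> oU sg; apply: (smooth_on_linear (L := fst : {linear gfiber -> 'rV[R]_n})) => //.
by move=> u; exact: cvg_fst.
Qed.

Lemma smooth_on_snd (V : normedModType R) (U : set V) (g : V -> @gfiber R n) :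
  open U -> smooth_on U g -> smooth_on U (fun y => (g y).2).
Proof.
move=> oU sg; apply: (smooth_on_linear (L := snd : {linear gfiber -> 'cV[R]_n})) => //.
by move=> u; exact: cvg_snd.
Qed.

Lemma smooth_section_chart c W e : open W -> W `<=` chart_dom c ->
  smooth_on (chart c @` (W `&` chart_dom c))
    (fun y => tocoord c (chart_inv c y) (e (chart_inv c y))) ->
  smooth_section A W e.
Proof.
move=> oW Wc; pose E y := tocoord c (chart_inv c y) (e (chart_inv c y)).
rewrite -/E => se i.
have oi : open (chart i @` (W `&` chart_dom i)) by exact: chart_image_open.
have oc : open (chart c @` (W `&` chart_dom c)) by exact: chart_image_open.
apply: (@smooth_on_eq _ _ _ _ (fun y =>
  ((E ((chart c \o chart_inv i) y)).1 *m cjac c i (chart_inv i y),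
   cjac i c (chart_inv i y) *m (E ((chart c \o chart_inv i) y)).2) : gfiber)).
- exact: oi.
- move=> y; rewrite inE => -[x [Wx ix] <-] /=; have cx := Wc _ Wx.
  by rewrite section_coordsE /E !chartK// (tocoord_transition _ cx ix).
apply: smooth_on_gfiber; first exact: oi.
  apply: smooth_mxM => //=; last exact: jac_inv_smooth.
  move=> k l; apply: (@smooth_on_transition i c W (fun y => (E y).1 k l)) => //.
  by apply: smooth_on_coord => //; exact: smooth_on_fst.
apply: smooth_mxM => //=; first exact: jac_smooth.
move=> k l; apply: (@smooth_on_transition i c W (fun y => (E y).2 k l)) => //.
by apply: smooth_on_coord => //; exact: smooth_on_snd.
Qed.

(** If [g] did not vanish at the point, it would be nonzero on a neighbourhood, which meets [D].
    Identities between smooth coefficients reach the singular points in this way. *)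
Lemma dense_chart_eq (D : set M) c W x0 (g : 'rV[R]_n -> R) : dense D -> open W ->
  W x0 -> chart_dom c x0 -> {for chart c x0, continuous g} ->
  (forall x, W x -> chart_dom c x -> D x -> g (chart c x) = 0) ->
  g (chart c x0) = 0.
Proof.
move=> dD oW Wx0 cx0 cg g0; apply/eqP/negP => /negP gx0.
have : \forall x \near x0, [/\ W x, chart_dom c x & g (chart c x) != 0].
  have n1 : \forall x \near x0, W x by exact: open_nbhs_nbhs.
  have n2 : \forall x \near x0, chart_dom c x.
    exact: open_nbhs_nbhs (conj (@chart_dom_open _ _ _ A c) cx0).
  have n3 : \forall x \near x0, g (chart c x) != 0.
    have cgc := continuous_comp (chart_continuous cx0) cg.
    by apply: (cgc [set z : R | z != 0]); apply: open_nbhs_nbhs; split=> //.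
  by near=> x; split; near: x.
rewrite /prop_near1 nbhsE => -[Q [oQ Qx0] QP].
have [|x [/QP[Wx cx /eqP]]] := dD Q _ oQ; first by exists x0.
by move=> gx Dx; apply: gx; exact: g0.
Unshelve. all: by end_near. Qed.

End Charts.

(** * From Lagrangian frames to spinors *)

Section Transversal.
Context {R : realType} {n : nat}.

(** The components that survive modulo the coordinate Lagrangian spanned by d/dx^i for i in S and
    dx^j for j not in S. For rows spanning a Lagrangian, invertibility says that the two Lagrangians
    are transversal. *)
Definition mixed_mx m (S : {set 'I_n}) (X a : 'M[R]_(m, n)) : 'M[R]_(m, n) :=
  \matrix_(k, i) (if i \in S then a k i else X k i).

Lemma mul_mixed_mx m p (S : {set 'I_n}) (X a : 'M[R]_(m, n)) (v : 'M[R]_(p, m)) :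
  v *m mixed_mx S X a = mixed_mx S (v *m X) (v *m a).
Proof.
apply/matrixP => k i; rewrite !mxE; case: ifP => iS; apply: eq_bigr => j _;
  by rewrite !mxE iS.
Qed.

(* [~: S] indexes a maximal independent family of columns of [X]; isotropy then
   forces any vector of the coordinate Lagrangian given by [S] to vanish. *)
Lemma isotropic_transversal (X a : 'M[R]_n) :
  X *m a^T + a *m X^T = 0 ->
  (forall v : 'rV_n, v *m X = 0 -> v *m a = 0 -> v = 0) ->
  exists S : {set 'I_n}, mixed_mx S X a \in unitmx.
Proof.
move=> iso free; pose f := maxrankfun X^T.
pose S := [set i | i \notin codom f]%SET; exists S.
rewrite -row_free_unit -kermx_eq0; apply/eqP/row_matrixP => k.
set v := row k _; rewrite row0.
have : v *m mixed_mx S X a = 0 by rewrite -row_mul mulmx_ker row0.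
rewrite mul_mixed_mx => /rowP v0.
have vX i : i \notin S -> (v *m X) 0 i = 0.
  by move=> /negbTE iS; have := v0 i; rewrite [LHS]mxE iS [RHS]mxE.
have va i : i \in S -> (v *m a) 0 i = 0.
  by move=> iS; have := v0 i; rewrite [LHS]mxE iS [RHS]mxE.
(* [v *m X] vanishes at the selected columns, and the other columns of [X] are combinations of
   these. *)
have X0 : v *m X = 0.
  have /submxP[D XD] : (X^T <= rowsub f X^T)%MS by rewrite (eq_maxrowsub X^T).
  have r0 : rowsub f X^T *m v^T = 0.
    apply/colP => j; have := vX (f j); rewrite inE negbK codom_f => /(_ isT).
    rewrite !mxE => E; rewrite -[RHS]E; apply: eq_bigr => l _.
    by rewrite !mxE mulrC.
  by apply: trmx_inj; rewrite trmx_mul XD -mulmxA r0 mulmx0 trmx0.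
apply: free => //.
(* Isotropy now says that the entries of [v *m a] form a linear relation among the columns of [X].
   It involves only the selected columns, which are independent. *)
have aX : (v *m a) *m X^T = 0.
  move/(congr1 (mulmx v)): iso; rewrite mulmxDr !mulmxA X0 mul0mx add0r.
  by rewrite mulmx0.
have b0 : (\row_j (v *m a) 0 (f j)) *m rowsub f X^T = 0.
  apply/rowP => l; move/rowP/(_ l) : aX; rewrite [RHS]mxE [in X in _ -> X]mxE.
  rewrite [LHS]mxE => E; rewrite [RHS]mxE -[RHS]E.
  rewrite [RHS](bigID (mem (codom f))) /= [X in _ = _ + X]big1 ?addr0; last first.
    by move=> i iS; rewrite va ?mul0r// inE.
  have fu : uniq (codom f).
    by rewrite map_inj_uniq ?enum_uniq//; exact: maxrankfun_inj.
  rewrite -big_uniq// /codom /image_mem big_map big_enum /=.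
  by apply: eq_bigr => j _; rewrite !mxE.
have f_free : row_free (rowsub f X^T) by exact: maxrowsub_free.
have {}b0 : \row_j (v *m a) 0 (f j) = 0.
  by apply: (row_free_inj f_free); rewrite b0 mul0mx.
apply/rowP => l; rewrite [RHS]mxE.
have [/va //|] := boolP (l \in S).
rewrite inE negbK => /codomP[j ->].
by move/rowP/(_ j) : b0; rewrite mxE => ->; rewrite mxE.
Qed.

End Transversal.

Section PreformValues.
Context {R : realType} {n : nat}.
Implicit Types (a : @preform R n) (s : seq 'rV[R]_n) (t : seq 'I_n).

Lemma multilinear_sum a (X : 'rV[R]_n) s : multilinear a ->
  a (X :: s) = \sum_j X 0 j * a (basis_vector j :: s).
Proof.
move=> h; rewrite mlextE//=; apply: eq_bigr => j _; congr *%R.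
exact: (esym (mlextE s (multilinear_iprod (basis_vector j) h))).
Qed.

Lemma pairing_basis j (al : 'cV[R]_n) : pairing (basis_vector j) al = al j 0.
Proof. by rewrite /pairing -rowE mxE. Qed.

End PreformValues.

(** * Smooth ratios of spinor components *)

Section SpinorRecursion.
Context {R : realType} {n : nat} {V : normedModType R}.
Context (U D : set V) (oU : open U) (eps : V -> @preform R n).
Context (alt : forall y, D y -> alternating_form (eps y)).
Context (S : {set 'I_n}) (X : 'I_n -> V -> 'rV[R]_n) (al : 'I_n -> V -> 'cV[R]_n).
Context (X_smooth : forall i, smooth_mx U (X i)).
Context (al_smooth : forall i, smooth_mx U (al i)).
Context (X_normal : forall i j y, D y -> j \notin S -> X i y 0 j = (i == j)%:R).
Context (al_normal : forall i j y, D y -> j \in S -> al i y j 0 = (i == j)%:R).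
Context (annihilate : forall i y s, D y -> clifford (X i y, al i y) (eps y) s = 0).

Let bv := @basis_vector R n.

(** [D] stands for the regular points and [U] for a full open set: the comparison with the
    dx^S-component is made on [D], while [g] is smooth on all of [U]. The product form presupposes
    no nonvanishing of that component. *)
Definition smooth_ratio (h : V -> R) := exists2 g : V -> R, smooth_on U g &
  forall y, D y -> h y = g y * eps y (map bv (enum S)).

Lemma smooth_ratio_eq h h' : (forall y, D y -> h y = h' y) ->
  smooth_ratio h -> smooth_ratio h'.
Proof. by move=> hh' [g sg hg]; exists g => // y Dy; rewrite -hh'// hg. Qed.

Lemma smooth_ratio0 h : (forall y, D y -> h y = 0) -> smooth_ratio h.
Proof.
move=> h0; exists (fun=> 0); first exact: smooth_on_cst.
by move=> y Dy; rewrite h0// mul0r.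
Qed.

Lemma smooth_ratioD h h' : smooth_ratio h -> smooth_ratio h' ->
  smooth_ratio (fun y => h y + h' y).
Proof.
move=> [g sg hg] [g' sg' hg']; exists (fun y => g y + g' y).
  exact: smooth_onD.
by move=> y Dy; rewrite hg// hg'// mulrDl.
Qed.

Lemma smooth_ratioM (f : V -> R) h : smooth_on U f -> smooth_ratio h ->
  smooth_ratio (fun y => f y * h y).
Proof.
move=> sf [g sg hg]; exists (fun y => f y * g y); first exact: smooth_onM.
by move=> y Dy; rewrite hg// mulrA.
Qed.

Lemma smooth_ratioN h : smooth_ratio h -> smooth_ratio (fun y => - h y).
Proof.
move=> /(smooth_ratioM (smooth_on_cst U (-1 : R))); apply: smooth_ratio_eq.
by move=> y _; rewrite mulN1r.
Qed.

Lemma smooth_ratio_sum (h : 'I_n -> V -> R) : (forall i, smooth_ratio (h i)) ->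
  smooth_ratio (fun y => \sum_i h i y).
Proof.
move=> hh; elim: (index_enum _) => [|i r IH].
  by apply: smooth_ratio0 => y _; rewrite big_nil.
apply: smooth_ratio_eq (smooth_ratioD (hh i) IH) => y _.
by rewrite big_cons.
Qed.

Lemma smooth_ratio_ext i (b : V -> preform) t :
  (forall p k q, t = p ++ k :: q ->
    smooth_ratio (fun y => al i y k 0 * b y (map bv (p ++ q)))) ->
  smooth_ratio (fun y => ext (fun v => pairing v (al i y)) (b y) (map bv t)).
Proof.
elim: t b => [|k t IH] b h /=; first exact: smooth_ratio0.
apply: smooth_ratioD.
  apply: smooth_ratio_eq (h [::] k t erefl) => y _ /=.
  by rewrite pairing_basis.
apply: smooth_ratioN; apply: (IH (fun y => iprod (bv k) (b y))) => p l q tE.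
by apply: (h (k :: p) l q); rewrite tE.
Qed.

(** The symmetric difference with [S]; its size is the measure of the recursion. *)
Let sd (t : seq 'I_n) := finset (fun x => (x \in t) (+) (x \in S)).

Lemma sd_lt t2 t1 i : (forall x, x \in sd t2 -> x \in sd t1) ->
  i \in sd t1 -> i \notin sd t2 -> (#|sd t2| < #|sd t1|)%N.
Proof.
move=> h i1 i2; apply: proper_card; apply/properP; split; last by exists i.
by apply/fintype.subsetP.
Qed.

Lemma smooth_ratio_perm t t' : perm_eq t t' ->
  smooth_ratio (fun y => eps y (map bv t')) ->
  smooth_ratio (fun y => eps y (map bv t)).
Proof.
move=> /(perm_alternating bv)[k hk] h.
apply: smooth_ratio_eq (smooth_ratioM (smooth_on_cst U ((-1) ^+ k : R)) h).
by move=> y Dy; rewrite hk//; exact: alt.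
Qed.

(** The equation of the i-th frame vector is used at an index [i] of the symmetric difference, so
    that the normalized coefficient 1 multiplies the wanted component. Every other term has
    coefficient 0 by normalization, repeats an index, or belongs to a strictly smaller symmetric
    difference. *)
Lemma spinor_smooth_ratio t : smooth_ratio (fun y => eps y (map bv t)).
Proof.
have [m] := ubnP #|sd t|; elim: m t => [//|m IH] t; rewrite ltnS => tm.
have {}IH t' : (#|sd t'| < #|sd t|)%N -> smooth_ratio (fun y => eps y (map bv t')).
  by move=> t't; apply: IH; exact: leq_trans t't tm.
have [tu|tu] := boolP (uniq t); last first.
  by apply: smooth_ratio0 => y Dy; apply: alternating_not_uniq => //; exact: alt.
have multi y : D y -> multilinear (eps y) by move=> /alt[].
(* Case of an [i] in [t] outside [S]: on [t] without [i], the coefficient 1 of d/dx^i isolates the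
   wanted component. The other terms exchange [i] for an index of [S], or drop [i] together with
   another index outside [S]. *)
have [/hasP[i it iS]|/hasPn tS] := boolP (has (fun i => i \notin S) t).
  have [t' tE] : exists t', perm_eq t (i :: t').
    by exists (rem i t); exact: perm_to_rem.
  have tm' x : (x \in t) = (x == i) || (x \in t') by rewrite (perm_mem tE) inE.
  move: tu; rewrite (perm_uniq tE) /= => /andP[it' tu'].
  have sdi : i \in sd t by rewrite inE it (negbTE iS).
  apply: (smooth_ratio_perm tE).
  pose rest y := \sum_j (if j == i then 0 else
    X i y 0 j * eps y (map bv (j :: t'))).
  apply: (@smooth_ratio_eq (fun y => - (rest y +
    ext (fun v => pairing v (al i y)) (eps y) (map bv t')))).
    move=> y Dy; have := annihilate i (map bv t') Dy.
    rewrite /clifford /= multilinear_sum; last exact: multi.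
    rewrite (bigD1 i)//= X_normal// eqxx mul1r -addrA => /eqP.
    rewrite addr_eq0 => /eqP ->; congr (- (_ + _)).
    rewrite /rest (bigD1 i)//= eqxx add0r; apply: eq_bigr => j /negbTE ->.
    by [].
  apply/smooth_ratioN/smooth_ratioD.
    apply: smooth_ratio_sum => j; have [_|ji] := eqVneq j i.
      exact: smooth_ratio0.
    have [jS|jS] := boolP (j \in S); last first.
      by apply: smooth_ratio0 => y Dy; rewrite X_normal// eq_sym (negbTE ji) mul0r.
    apply: (smooth_ratioM (X_smooth i 0 j)).
    have [jt|jt] := boolP (j \in t').
      apply: smooth_ratio0 => y Dy; apply: alternating_not_uniq; first exact: alt.
      by rewrite /= jt.
    apply: IH; apply: (sd_lt (i := i)) => //; last first.
      by rewrite inE in_cons eq_sym (negbTE ji) (negbTE it') (negbTE iS).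
    move=> x; rewrite !inE tm'; have [->|xj] := eqVneq x j; first by rewrite jS.
    by have [->|xi] := eqVneq x i; rewrite //= (negbTE it') (negbTE iS).
  apply: smooth_ratio_ext => p k q t'E.
  have [kS|kS] := boolP (k \in S).
    apply: smooth_ratio0 => y Dy; rewrite al_normal//.
    by have [ik|_] := eqVneq i k; [move: iS; rewrite ik kS|rewrite mul0r].
  apply: (smooth_ratioM (al_smooth i k 0)); apply: IH.
  have kpq : k \notin p ++ q.
    move: tu'; rewrite t'E -cat_rcons -cats1 -catA uniq_catCA /= => /andP[].
    by rewrite mem_cat.
  apply: (sd_lt (i := i)) => //; last first.
    rewrite inE (negbTE iS) addbF; move: it'; rewrite t'E !mem_cat inE !negb_or.
    by case/and3P=> -> _ ->.
  move=> x; rewrite !inE tm' t'E !mem_cat inE.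
  have [->|xi] := eqVneq x i; first by rewrite (negbTE iS).
  have [->|xk] := eqVneq x k; last by [].
  by move: kpq; rewrite mem_cat (negbTE kS) => /negbTE ->.
(* Case of [t] inside [S] with some [i] in [S] missing: on [i :: t], the coefficient 1 of dx^i
   isolates the wanted component. The other covector terms vanish, and the vector terms add to [t]
   both [i] and a further index of [S]. *)
have [/hasP[i iS it]|/hasPn St] := boolP (has (fun i => i \notin t) (enum S)).
  rewrite mem_enum in iS.
  have sdi : i \in sd t by rewrite inE (negbTE it) iS.
  pose rest y := \sum_j X i y 0 j * eps y (map bv (j :: i :: t)).
  apply: (@smooth_ratio_eq (fun y =>
    ext (fun v => pairing v (al i y)) (iprod (bv i) (eps y)) (map bv t) - rest y)).
    move=> y Dy; have := annihilate i (map bv (i :: t)) Dy.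
    rewrite /clifford /= multilinear_sum; last exact: multi.
    rewrite pairing_basis al_normal// eqxx mul1r -/(rest y) => /eqP.
    rewrite addrA subr_eq0 => /eqP <-.
    by rewrite addrAC subrr add0r.
  apply: smooth_ratioD; last first.
    apply/smooth_ratioN/smooth_ratio_sum => j.
    have [jS|jS] := boolP (j \in S); last first.
      apply: smooth_ratio0 => y Dy; rewrite X_normal//.
      by have [ij|_] := eqVneq i j; [move: jS; rewrite -ij iS|rewrite mul0r].
    apply: (smooth_ratioM (X_smooth i 0 j)).
    have [jt|jt] := boolP (j \in i :: t).
      apply: smooth_ratio0 => y Dy; apply: alternating_not_uniq; first exact: alt.
      by rewrite /= jt.
    apply: IH; apply: (sd_lt (i := i)) => //; last first.
      by rewrite inE !in_cons eqxx orbT iS.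
    move=> x; rewrite !inE; have [->|xj] := eqVneq x j; first by rewrite jS.
    by have [->|xi] := eqVneq x i; rewrite //= iS.
  apply: smooth_ratio_ext => p k q tE.
  have kt : k \in t by rewrite tE mem_cat mem_head orbT.
  have kS : k \in S by have := tS _ kt; rewrite negbK.
  apply: smooth_ratio0 => y Dy; rewrite al_normal//.
  by have [ik|_] := eqVneq i k; [move: it; rewrite ik kt|rewrite mul0r].
(* Now [t] lists exactly the elements of [S], and the ratio is a constant sign. *)
apply: (@smooth_ratio_perm t (enum S)).
  apply: uniq_perm => //; first exact: enum_uniq.
  move=> x; rewrite mem_enum; apply/idP/idP => [/tS|xS]; first by rewrite negbK.
  by have := St x; rewrite mem_enum xS negbK => /(_ isT).
exists (fun=> 1); first exact: smooth_on_cst.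
by move=> y _; rewrite mul1r.
Qed.

End SpinorRecursion.

(** * From spinors to Lagrangian frames *)

Section CliffordLinear.
Context {R : realType} {n : nat}.
Implicit Types (rho : @preform R n) (u v k d : @gfiber R n).

Lemma pairing_linearr (X : 'rV[R]_n) (t : R) (a b : 'cV[R]_n) :
  pairing X (t *: a + b) = t * pairing X a + pairing X b.
Proof. by rewrite /pairing mulmxDr -scalemxAr !mxE. Qed.

Lemma pairing_linearl (t : R) (X Y : 'rV[R]_n) (a : 'cV[R]_n) :
  pairing (t *: X + Y) a = t * pairing X a + pairing Y a.
Proof. by rewrite /pairing mulmxDl -scalemxAl !mxE. Qed.

Lemma isotropic_pairingC u v : isotropic_pairing u v = isotropic_pairing v u.
Proof. by rewrite /isotropic_pairing addrC. Qed.

Lemma isotropic_pairing_linear (t : R) u v (z : gfiber) :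
  isotropic_pairing (t *: u + v) z =
  t * isotropic_pairing u z + isotropic_pairing v z.
Proof.
rewrite /isotropic_pairing -[(t *: u + v).1]/(t *: u.1 + v.1).
rewrite -[(t *: u + v).2]/(t *: u.2 + v.2) pairing_linearl pairing_linearr.
by ring.
Qed.

Lemma isotropic_pairing_sumr (u : @gfiber R n) (I : finType) (a : I -> R) (v : I -> gfiber) :
  (forall i, isotropic_pairing u (v i) = 0) ->
  isotropic_pairing u (\sum_i a i *: v i) = 0.
Proof.
move=> h; rewrite isotropic_pairingC; elim: (index_enum _) => [|i s IH].
  by rewrite big_nil /isotropic_pairing /pairing mul0mx mulmx0 !mxE addr0 mulr0.
by rewrite big_cons isotropic_pairing_linear isotropic_pairingC h IH mulr0 addr0.
Qed.

Lemma ext_linear (t : R) (be ga : 'rV[R]_n -> R) rho s :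
  ext (fun z => t * be z + ga z) rho s = t * ext be rho s + ext ga rho s.
Proof.
elim: s rho => [|v s IH] rho /=; first by rewrite mulr0 addr0.
by rewrite IH; ring.
Qed.

Lemma clifford_linear (t : R) u v rho s : multilinear rho ->
  clifford (t *: u + v) rho s = t * clifford u rho s + clifford v rho s.
Proof.
move=> h; rewrite /clifford -[(t *: u + v).1]/(t *: u.1 + v.1) (h [::]) /=.
rewrite (@eq_ext _ _ _ (fun z => t * pairing z u.2 + pairing z v.2)); last first.
  by move=> z; exact: pairing_linearr.
by rewrite ext_linear; ring.
Qed.

Lemma cliffordZr (f : R) u rho s :
  clifford u (fun s => f * rho s) s = f * clifford u rho s.
Proof.
rewrite /clifford mulrDr; congr +%R.
elim: s rho => [|v s IH] rho /=; first by rewrite mulr0.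
by rewrite (IH (iprod v rho)) mulrBr mulrCA.
Qed.

Lemma smooth_clifford (V : normedModType R) (U : set V) (rho : V -> preform) d t :
  open U -> (forall y, U y -> multilinear (rho y)) ->
  (forall t, smooth_on U (fun y => rho y (map basis_vector t))) ->
  smooth_on U (fun y => clifford d (rho y) (map basis_vector t)).
Proof.
move=> oU mU sU; apply: smooth_onD => //.
  apply: (@smooth_on_eq _ _ _ _
    (fun y => \sum_j d.1 0 j * rho y (map basis_vector (j :: t)))) => //.
    by move=> y; rewrite inE => Uy /=; rewrite multilinear_sum//; exact: mU.
  apply: smooth_on_sum => // j; apply: smooth_onM => //.
  exact: smooth_on_cst.
elim: t rho {mU} sU => [|k t IH] rho sU /=; first exact: smooth_on_cst.
apply: smooth_onD => //.
  by apply: smooth_onM => //; exact: smooth_on_cst.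
apply: smooth_onN => //; apply: (IH (fun y => iprod (basis_vector k) (rho y))) => t'.
exact: (sU (k :: t')).
Qed.

End CliffordLinear.

(** * Frames solving the annihilation equations *)

Section NormalFrame.
Context {R : realType} {n : nat} (t0 : seq 'I_n).
Implicit Types (rho : @preform R n) (u v k d : @gfiber R n).
Let bv := @basis_vector R n.

(** Components modulo the coordinate Lagrangian belonging to [t0], as in [mixed_mx] but for a single
    vector; on the complementary Lagrangian spanned by [cobasis] they are the coordinates. *)
Definition coefs u : 'rV[R]_n :=
  \row_i (if i \in t0 then u.2 i 0 else u.1 0 i).

Definition cobasis i : @gfiber R n :=
  if i \in t0 then (0, delta_mx i 0) else (delta_mx 0 i, 0).

(** The only candidate [k] in the coordinate Lagrangian for which [d + k] annihilates [rho], read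
    off by evaluating on [t0] with one index removed or added. The first denominator is the
    component along [t0] up to sign; keeping [j] in front avoids tracking that sign. *)
Definition residue rho d : @gfiber R n :=
  (\row_j (if j \in t0 then
     - (clifford d rho (map bv (rem j t0)) / rho (map bv (j :: rem j t0))) else 0),
   \col_l (if l \in t0 then 0 else
     - (clifford d rho (map bv (l :: t0)) / rho (map bv t0)))).

Definition normal_frame rho i := cobasis i + residue rho (cobasis i).

Lemma coefs_linear : linear coefs.
Proof.
move=> t u v; apply/rowP => i; rewrite !mxE.
by case: (i \in t0).
Qed.
HB.instance Definition _ := GRing.isLinear.Build R gfiber 'rV[R]_n _ coefs coefs_linear.

Lemma coefs_cobasis i : coefs (cobasis i) = delta_mx 0 i.
Proof.
apply/rowP => j; rewrite /cobasis; have [->|ji] := eqVneq j i.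
  by rewrite !mxE; case: (i \in t0); rewrite /= mxE !eqxx.
rewrite !mxE (negbTE ji) andbF; case: (boolP (i \in t0)) => it;
  case: (boolP (j \in t0)) => jt; rewrite /= !mxE ?(negbTE ji) ?andbF//.
Qed.

Lemma coefs_residue rho d : coefs (residue rho d) = 0.
Proof. by apply/rowP => j; rewrite !mxE; case: (j \in t0). Qed.

Lemma coefs_normal_frame rho i : coefs (normal_frame rho i) = delta_mx 0 i.
Proof. by rewrite linearD /= coefs_cobasis coefs_residue addr0. Qed.

Lemma coefs0_fst k j : coefs k = 0 -> j \notin t0 -> k.1 0 j = 0.
Proof. by move=> /rowP/(_ j); rewrite !mxE => + /negbTE jt; rewrite jt. Qed.

Lemma coefs0_snd k j : coefs k = 0 -> j \in t0 -> k.2 j 0 = 0.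
Proof. by move=> /rowP/(_ j); rewrite !mxE => + jt; rewrite jt. Qed.

(** The vector part of [k] points along indices of [t0] and produces repeated arguments; its
    covector part vanishes on those indices, so only the pairing with [l] remains. *)
Lemma clifford_coefs0_snd rho k l : alternating_form rho -> coefs k = 0 ->
  clifford k rho (map bv (l :: t0)) = k.2 l 0 * rho (map bv t0).
Proof.
move=> ar k0; rewrite /clifford multilinear_sum; last by case: ar.
rewrite big1 ?add0r /=; last first.
  move=> j _; have [jt|jt] := boolP (j \in t0); last by rewrite coefs0_fst// mul0r.
  rewrite (@alternating_not_uniq _ _ rho (j :: l :: t0)) ?mulr0//=.
  by rewrite inE jt orbT.
rewrite ext0 ?subr0 ?pairing_basis// => _ /mapP[j jt ->].
by rewrite pairing_basis coefs0_snd.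
Qed.

Lemma clifford_coefs0_fst rho k j : alternating_form rho -> coefs k = 0 ->
  j \in t0 ->
  clifford k rho (map bv (rem j t0)) = k.1 0 j * rho (map bv (j :: rem j t0)).
Proof.
move=> ar k0 jt; rewrite /clifford multilinear_sum; last by case: ar.
rewrite [X in _ + X]ext0 ?addr0; last first.
  by move=> _ /mapP[i /mem_rem it ->]; rewrite pairing_basis coefs0_snd.
rewrite (bigD1 j)//= big1 ?addr0// => i ij.
have [it|it] := boolP (i \in t0); last by rewrite coefs0_fst// mul0r.
rewrite (@alternating_not_uniq _ _ rho (i :: rem j t0)) ?mulr0//=.
by move: it; rewrite (perm_mem (perm_to_rem jt)) inE (negbTE ij) /= => ->.
Qed.

Lemma rho_rem_neq0 rho j : alternating_form rho -> rho (map bv t0) != 0 ->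
  j \in t0 -> rho (map bv (j :: rem j t0)) != 0.
Proof.
move=> ar + jt; have [k hk] := perm_alternating bv (perm_to_rem jt).
by rewrite hk// mulf_eq0 negb_or => /andP[].
Qed.

Lemma coefs0_eq0 k : coefs k = 0 -> (forall j, j \in t0 -> k.1 0 j = 0) ->
  (forall j, j \notin t0 -> k.2 j 0 = 0) -> k = 0.
Proof.
move=> k0 h1 h2; apply: injective_projections.
  apply/rowP => j; rewrite mxE; have [/h1//|jt] := boolP (j \in t0).
  exact: coefs0_fst.
apply/colP => j; rewrite mxE; have [jt|/h2//] := boolP (j \in t0).
exact: coefs0_snd.
Qed.

(** Only a few of the annihilation equations are evaluated, enough for uniqueness. Existence is
    supplied by the graph in [in_graph_normal_frame]. *)
Lemma residue_unique rho d k : alternating_form rho -> rho (map bv t0) != 0 ->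
  coefs k = 0 -> (forall s, clifford (d + k) rho s = 0) -> k = residue rho d.
Proof.
move=> ar r0 k0 h; have mr : multilinear rho by case: ar.
have {}h s : clifford k rho s = - clifford d rho s.
  have := h s; rewrite -{1}[d]scale1r clifford_linear// mul1r => /eqP.
  by rewrite addr_eq0 => /eqP ->; rewrite opprK.
apply: injective_projections.
  apply/rowP => j; rewrite mxE; case: ifPn => jt; last exact: coefs0_fst.
  have := h (map bv (rem j t0)); rewrite clifford_coefs0_fst// => E.
  by rewrite -mulNr -E mulfK//; exact: rho_rem_neq0.
apply/colP => l; rewrite mxE; case: ifPn => lt; first exact: coefs0_snd.
have := h (map bv (l :: t0)); rewrite clifford_coefs0_snd// => E.
by rewrite -mulNr -E mulfK.
Qed.

Lemma residue0 rho : alternating_form rho -> residue rho 0 = 0.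
Proof.
move=> ar; have mr : multilinear rho by case: ar.
have c0 s : clifford 0 rho s = 0.
  by rewrite -[0 : gfiber]addr0 -{1}[0 : gfiber](scaler0 _ (-1)) clifford_linear// mulN1r addNr.
by congr pair; [apply/rowP|apply/colP] => j; rewrite !mxE c0 mul0r oppr0 if_same.
Qed.

Lemma in_graph_linear w (t : R) u v : multilinear w -> in_graph w u -> in_graph w v ->
  in_graph w (t *: u + v).
Proof.
move=> mw gu gv z; rewrite -[(t *: u + v).1]/(t *: u.1 + v.1) (mw [::]) /=.
by rewrite pairing_linearr gu gv.
Qed.

Lemma in_graph_sum (a : @preform R n) (I : finType) (t : I -> R) (v : I -> gfiber) :
  multilinear a -> (forall i, in_graph a (v i)) -> in_graph a (\sum_i t i *: v i).
Proof.
move=> ma h; elim: (index_enum _) => [|i s IH]; last first.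
  by rewrite big_cons; exact: in_graph_linear.
rewrite big_nil => z; have := ma [::] [:: z] (-1) 0 0.
rewrite /= scaler0 addr0 mulN1r addNr => E.
by rewrite -[RHS]/(a [:: 0; z]) E /pairing mulmx0 mxE.
Qed.

Lemma in_graph_isotropic w u v : alternating_form w -> in_graph w u -> in_graph w v ->
  isotropic_pairing u v = 0.
Proof.
move=> /alternatingP[mw nw] gu gv; rewrite /isotropic_pairing gu gv.
by rewrite (multilinear_swap _ _ _ mw nw) addNr mulr0.
Qed.

Definition graph_vector (w : preform) (X : 'rV[R]_n) : @gfiber R n :=
  (X, \col_j w [:: X; bv j]).

Lemma graph_vectorP w X : multilinear w -> in_graph w (graph_vector w X).
Proof.
move=> mw v; rewrite /pairing mxE /=.
rewrite -[RHS]/(iprod X w [:: v]) multilinear_sum; last exact: multilinear_iprod.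
by apply: eq_bigr => j _; rewrite mxE.
Qed.

Lemma graph_vector_linear w : multilinear w -> linear (graph_vector w).
Proof.
move=> mw t X Y; congr pair; apply/colP => j; rewrite !mxE.
exact: (mw [::]).
Qed.

(** [coefs] is injective on the graph by [residue_unique] at d = 0, hence bijective, as the graph
    has dimension [n]. The graph vector with the coefficients of [cobasis i] differs from
    [cobasis i] by the residue, again by uniqueness. *)
Lemma in_graph_normal_frame w f i : alternating_form w -> homogeneous 2 w ->
  f * exp_neg w (map bv t0) != 0 ->
  in_graph w (normal_frame (fun s => f * exp_neg w s) i).
Proof.
move=> aw hw r0; set rho := fun s => _.
have mw : multilinear w by case: aw.
have ae := exp_neg_alternating aw.
have ar : alternating_form rho.
  split=> [s1 s2 t u v|s1 s2 s3 u]; rewrite /rho; first by case: ae => -> _; ring.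
  by case: ae => _ ->; rewrite mulr0.
have ann u s : in_graph w u -> clifford u rho s = 0.
  by move=> gu; rewrite cliffordZr clifford_exp_neg// mulr0.
pose L := graph_vector w.
pose lL := graph_vector_linear mw.
pose cL : {linear 'rV[R]_n -> 'rV[R]_n} := HB.pack (coefs \o L)
  (GRing.isLinear.Build R 'rV[R]_n 'rV[R]_n _ (coefs \o L)
    (fun t x z => etrans (congr1 coefs (lL t x z)) (coefs_linear t (L x) (L z)))).
pose G := lin1_mx cL.
have GE X : X *m G = coefs (L X) by rewrite /G mul_rV_lin1.
have Gu : G \in unitmx.
  rewrite -row_free_unit -kermx_eq0; apply/eqP/row_matrixP => k; rewrite row0.
  set X := row k _; have : X *m G = 0 by rewrite -row_mul mulmx_ker row0.
  rewrite GE => c0.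
  suff : L X = 0 by case.
  rewrite (@residue_unique rho 0 (L X)) ?residue0// => s.
  by rewrite add0r; apply: ann; exact: graph_vectorP.
pose X : 'rV[R]_n := delta_mx 0 i *m invmx G.
have cX : coefs (L X) = delta_mx 0 i by rewrite -GE mulmxKV.
suff <- : (L X : gfiber) = normal_frame rho i by exact: graph_vectorP.
rewrite /normal_frame -(@residue_unique rho (cobasis i) (L X - cobasis i))//.
- by rewrite addrC subrK.
- by rewrite linearB /= cX coefs_cobasis subrr.
- by move=> s; rewrite addrC subrK; apply: ann; exact: graph_vectorP.
Qed.

Lemma isotropic_coefs0 k d : coefs k = 0 -> coefs d = 0 -> isotropic_pairing k d = 0.
Proof.
move=> k0 d0; rewrite /isotropic_pairing /pairing !mxE !big1 ?addr0 ?mulr0// => j _;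
  have [jt|jt] := boolP (j \in t0).
- by rewrite (coefs0_snd k0 jt) mulr0.
- by rewrite (coefs0_fst d0 jt) mul0r.
- by rewrite (coefs0_snd d0 jt) mulr0.
- by rewrite (coefs0_fst k0 jt) mul0r.
Qed.

Lemma isotropic_cobasis k i : isotropic_pairing k (cobasis i) =
  2^-1 * (if i \in t0 then k.1 0 i else k.2 i 0).
Proof.
rewrite /isotropic_pairing /cobasis; case: ifP => it /=; congr *%R.
  by rewrite /pairing mul0mx !mxE addr0 -[RHS]mulr1 (bigD1 i)//= !mxE !eqxx
    big1 ?addr0// => j ji; rewrite mxE (negbTE ji) mulr0.
by rewrite {1}/pairing mulmx0 mxE add0r -[delta_mx 0 i]/(basis_vector i) pairing_basis.
Qed.

(** The difference of the two sides lies in the coordinate Lagrangian and is orthogonal to all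
    [F i]. Since [F i - cobasis i] lies in the same isotropic space, the difference is orthogonal to
    each [cobasis i], and these detect its remaining components. *)
Lemma orthogonal_normal_span (F : 'I_n -> @gfiber R n) u :
  (forall i, coefs (F i) = delta_mx 0 i) ->
  (forall i j, isotropic_pairing (F i) (F j) = 0) ->
  (forall i, isotropic_pairing u (F i) = 0) ->
  u = \sum_i coefs u 0 i *: F i.
Proof.
move=> cF iF iu; set v := \sum_i _; apply/eqP; rewrite -subr_eq0; apply/eqP.
set w := u - v.
have sum_coefs : coefs v = coefs u.
  rewrite linear_sum [RHS]row_sum_delta; apply: eq_bigr => i _.
  by rewrite linearZ /= cF.
have cw : coefs w = 0 by rewrite linearB /= sum_coefs subrr.
have iv i : isotropic_pairing v (F i) = 0.
  rewrite /v; elim/big_ind: _ => [|x y hx hy|j _].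
  - by rewrite /isotropic_pairing /pairing mul0mx mulmx0 !mxE addr0 mulr0.
  - by rewrite -[x]scale1r isotropic_pairing_linear hx hy mulr0 addr0.
  - rewrite -[_ *: F j]addr0 isotropic_pairing_linear iF mulr0 add0r.
    by rewrite /isotropic_pairing /pairing mul0mx mulmx0 !mxE addr0 mulr0.
have iw i : isotropic_pairing w (F i) = 0.
  by rewrite /w addrC -scaleN1r isotropic_pairing_linear iu iv mulr0 addr0.
have ic i : isotropic_pairing w (cobasis i) = 0.
  have -> : cobasis i = -1 *: (F i - cobasis i) + F i.
    by rewrite scaleN1r opprB subrK.
  rewrite isotropic_pairingC isotropic_pairing_linear [X in _ + X]isotropic_pairingC.
  rewrite iw addr0 isotropic_coefs0 ?mulr0// linearB /= cF coefs_cobasis subrr//.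
have h2 : (2^-1 : R) != 0 by rewrite invr_eq0 pnatr_eq0.
apply: coefs0_eq0 => // j jt; have := ic j; rewrite isotropic_cobasis.
  by rewrite jt => /eqP; rewrite mulf_eq0 (negbTE h2) => /eqP.
by rewrite (negbTE jt) => /eqP; rewrite mulf_eq0 (negbTE h2) => /eqP.
Qed.

Lemma smooth_normal_frame (V : normedModType R) (U : set V) (rho : V -> preform) i :
  open U -> (forall y, U y -> alternating_form (rho y)) ->
  (forall t, smooth_on U (fun y => rho y (map bv t))) ->
  (forall y, U y -> rho y (map bv t0) != 0) ->
  smooth_mx U (fun y => (normal_frame (rho y) i).1) /\
  smooth_mx U (fun y => (normal_frame (rho y) i).2).
Proof.
move=> oU aU sU r0; have mU y : U y -> multilinear (rho y) by move=> /aU[].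
have sc t : smooth_on U (fun y => clifford (cobasis i) (rho y) (map bv t)).
  exact: smooth_clifford.
split=> k l.
  apply: (@smooth_on_eq _ _ _ _ (fun y => (cobasis i).1 0 l +
    (if l \in t0 then - (clifford (cobasis i) (rho y) (map bv (rem l t0)) /
      rho y (map bv (l :: rem l t0))) else 0))) => //.
    by move=> y _; rewrite !mxE ord1.
  apply: smooth_onD => //; first exact: smooth_on_cst.
  have [lt|lt] := boolP (l \in t0); last exact: smooth_on_cst.
  apply: smooth_onN => //; apply: smooth_onM => //; apply: smooth_onV => //.
  by move=> y Uy; apply: rho_rem_neq0 => //; [exact: aU|exact: r0].
apply: (@smooth_on_eq _ _ _ _ (fun y => (cobasis i).2 k 0 +
  (if k \in t0 then 0 else - (clifford (cobasis i) (rho y) (map bv (k :: t0)) /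
    rho y (map bv t0))))) => //.
  by move=> y _; rewrite !mxE ord1.
apply: smooth_onD => //; first exact: smooth_on_cst.
have [kt|kt] := boolP (k \in t0); first exact: smooth_on_cst.
by apply: smooth_onN => //; apply: smooth_onM => //; exact: smooth_onV.
Qed.

End NormalFrame.

(** * Closed forms and the Dorfman bracket *)

Section DifferentiateForms.
Context {R : realType} {n : nat}.
Local Notation E := 'rV[R]_n.

Lemma derive_coord (V : normedModType R) m p (f : V -> 'M[R]_(m, p)) x v i j :
  differentiable f x -> 'D_v (fun y => f y i j) x = 'D_v f x i j.
Proof. by move=> df; rewrite derive_mx ?mxE//; exact: diff_derivable. Qed.

Lemma differentiable_entry (V : normedModType R) m p (f : V -> 'M[R]_(m, p)) x i j :
  differentiable f x -> differentiable (fun y => f y i j : R) x.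
Proof.
move=> df.
apply: (@differentiable_comp _ _ _ _ f (fun N : 'M[R]_(m, p) => N i j : R)) => //.
exact: differentiable_coord.
Qed.

Lemma bilinear_expansion (b : @preform R n) (p q : E) : multilinear b ->
  b [:: p; q] =
  \sum_j \sum_k p 0 j * q 0 k * b [:: basis_vector j; basis_vector k].
Proof.
move=> mb; rewrite mlextE//=; apply: eq_bigr => j _.
by rewrite big_distrr; apply: eq_bigr => k _ /=; rewrite mulrA.
Qed.

(** Leibniz and chain rule in one. [preform] carries no norm here, so the differentiation goes
    through the finitely many coefficients of [B] on basis vectors. *)
Lemma derive_bilinear (B : E -> preform) (phi P Q : E -> E) y0 h (N : set E) :
  open N -> N (phi y0) -> (forall z, N z -> multilinear (B z)) ->
  (forall j k, differentiable
    (fun z => B z [:: basis_vector j; basis_vector k] : R) (phi y0)) ->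
  differentiable phi y0 -> differentiable P y0 -> differentiable Q y0 ->
  'D_h (fun y => B (phi y) [:: P y; Q y]) y0 =
  'D_('D_h phi y0) (fun z => B z [:: P y0; Q y0]) (phi y0) +
  B (phi y0) [:: 'D_h P y0; Q y0] + B (phi y0) [:: P y0; 'D_h Q y0].
Proof.
move=> oN N0 mB dB dphi dP dQ.
pose b j k z : R := B z [:: basis_vector j; basis_vector k].
have nN : \forall z \near phi y0, N z by exact: open_nbhs_nbhs.
have nNy : \forall y \near y0, N (phi y).
  exact: (differentiable_continuous dphi).
rewrite (@near_eq_derive _ _ _ _ (fun y =>
  \sum_j \sum_k P y 0 j * Q y 0 k * b j k (phi y))); last first.
  by apply: filterS nNy => y Ny; rewrite bilinear_expansion//; exact: mB.
rewrite (@near_eq_derive _ _ _ (fun z => B z [:: P y0; Q y0]) (fun z =>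
  \sum_j \sum_k P y0 0 j * Q y0 0 k * b j k z)); last first.
  by apply: filterS nN => z Nz; rewrite bilinear_expansion//; exact: mB.
have dPj j : is_derive y0 h (fun y => P y 0 j) ('D_h P y0 0 j).
  rewrite -(derive_coord _ _ _ dP); apply: derivableP; apply: diff_derivable.
  exact: differentiable_entry.
have dQk k : is_derive y0 h (fun y => Q y 0 k) ('D_h Q y0 0 k).
  rewrite -(derive_coord _ _ _ dQ); apply: derivableP; apply: diff_derivable.
  exact: differentiable_entry.
have dbp j k : is_derive y0 h (b j k \o phi) ('D_('D_h phi y0) (b j k) (phi y0)).
  rewrite -(derive_comp h dphi erefl (dB j k)); apply: derivableP.
  by apply: diff_derivable; apply: differentiable_comp => //; exact: dB.
have db j k : is_derive (phi y0) ('D_h phi y0) (b j k) ('D_('D_h phi y0) (b j k) (phi y0)).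
  by apply: derivableP; apply: diff_derivable; exact: dB.
have D1 : is_derive y0 h (fun y => \sum_j \sum_k P y 0 j * Q y 0 k * b j k (phi y))
  (\sum_j \sum_k (P y0 0 j * Q y0 0 k * 'D_('D_h phi y0) (b j k) (phi y0) +
    b j k (phi y0) * (P y0 0 j * 'D_h Q y0 0 k + Q y0 0 k * 'D_h P y0 0 j))).
  rewrite (_ : (fun y => _) = \sum_j \sum_k ((fun y => P y 0 j) * (fun y => Q y 0 k) *
    (b j k \o phi))); last first.
    by apply/funext => y; rewrite fct_sumE; apply: eq_bigr => j _; rewrite fct_sumE.
  apply: is_derive_sum => j; apply: is_derive_sum => k.
  exact: (is_deriveM (is_deriveM (dPj j) (dQk k)) (dbp j k)).
have D2 : is_derive (phi y0) ('D_h phi y0)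
  (fun z => \sum_j \sum_k P y0 0 j * Q y0 0 k * b j k z)
  (\sum_j \sum_k P y0 0 j * Q y0 0 k * 'D_('D_h phi y0) (b j k) (phi y0)).
  rewrite (_ : (fun z => _) = \sum_j \sum_k ((P y0 0 j * Q y0 0 k) *: b j k)); last first.
    by apply/funext => y; rewrite fct_sumE; apply: eq_bigr => j _; rewrite fct_sumE.
  by apply: is_derive_sum => j; apply: is_derive_sum => k.
have [_ ->] := D1; have [_ ->] := D2.
have mB0 := mB _ N0.
rewrite (bilinear_expansion ('D_h P y0) (Q y0) mB0).
rewrite (bilinear_expansion (P y0) ('D_h Q y0) mB0).
rewrite -!big_split; apply: eq_bigr => j _ /=.
rewrite -!big_split; apply: eq_bigr => k _ /=.
rewrite -/(b j k (phi y0)).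
move: (b j k (phi y0)) ('D_h P y0 0 j) ('D_h Q y0 0 k) (P y0 0 j) (Q y0 0 k)
  ('D_('D_h phi y0) (b j k) (phi y0)) => x1 x2 x3 x4 x5 x6.
by ring.
Qed.

Lemma smooth_directional p q (U : set 'rV[R]_n) (X : 'rV[R]_n -> 'rV[R]_n)
    (g : 'rV[R]_n -> 'M[R]_(p, q)) : open U -> smooth_on U X -> smooth_on U g ->
  smooth_mx U (fun y => 'D_(X y) g y).
Proof.
move=> oU sX sg k l; apply: (@smooth_on_eq _ _ _ _ (fun y =>
  \sum_i X y 0 i * 'D_(basis_vector i) g y k l)) => //.
  move=> y; rewrite inE => Uy; rewrite diff_rV; last exact: smooth_on_differentiable sg Uy.
  by rewrite summxE; apply: eq_bigr => i _; rewrite [RHS]mxE.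
apply: smooth_on_sum => // i; apply: smooth_onM => //; first exact: smooth_on_coord.
by apply: smooth_on_coord => //; exact: smooth_on_derive.
Qed.

Lemma smooth_pairing (V : normedModType R) (U : set V) (X : V -> 'rV[R]_n)
    (a : V -> 'cV[R]_n) : open U -> smooth_on U X -> smooth_on U a ->
  smooth_on U (fun y => pairing (X y) (a y)).
Proof.
move=> oU sX sa; apply: (@smooth_on_eq _ _ _ _ (fun y => \sum_k X y 0 k * a y k 0)) => //.
  by move=> y _; rewrite /pairing mxE.
by apply: smooth_on_sum => // k; apply: smooth_onM => //; exact: smooth_on_coord.
Qed.

Lemma smooth_dorfman (U : set 'rV[R]_n) (e1 e2 : 'rV[R]_n -> gfiber) : open U ->
  smooth_on U e1 -> smooth_on U e2 -> smooth_on U (dorfman_coords e1 e2).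
Proof.
move=> oU s1 s2.
have sX := smooth_on_fst oU s1; have sa := smooth_on_snd oU s1.
have sY := smooth_on_fst oU s2; have sb := smooth_on_snd oU s2.
apply: smooth_on_gfiber => //= k l.
  apply: (@smooth_on_eq _ _ _ _ (fun y =>
    'D_((e1 y).1) (fun z => (e2 z).1) y k l +
    - 'D_((e2 y).1) (fun z => (e1 z).1) y k l)) => //.
    by move=> y _; rewrite !mxE.
  by apply: smooth_onD => //; last apply: smooth_onN => //; exact: smooth_directional.
apply: (@smooth_on_eq _ _ _ _ (fun y =>
  ('D_((e1 y).1) (fun z => (e2 z).2) y k l +
   pairing ('D_(basis_vector k) (fun z => (e1 z).1) y) (e2 y).2) +
  - ('D_((e2 y).1) (fun z => (e1 z).2) y k l +
     - pairing (e2 y).1 ('D_(basis_vector k) (fun z => (e1 z).2) y)))) => //.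
  by move=> y _; rewrite !mxE.
apply: smooth_onD => //; first apply: smooth_onD => //.
- exact: smooth_directional.
- by apply: smooth_pairing => //; exact: smooth_on_derive.
apply: smooth_onN => //; apply: smooth_onD => //; first exact: smooth_directional.
by apply: smooth_onN => //; apply: smooth_pairing => //; exact: smooth_on_derive.
Qed.

Definition closed_at (B : E -> preform) y := forall u v z : E,
  'D_u (fun y => B y [:: v; z] : R) y - 'D_v (fun y => B y [:: u; z] : R) y +
  'D_z (fun y => B y [:: u; v] : R) y = 0.

Lemma pairing_derive (V : normedModType R) (b : V -> 'cV[R]_n) Z h y :
  differentiable b y -> pairing Z ('D_h b y) = 'D_h (fun y => pairing Z (b y)) y.
Proof.
move=> db.
have lZ : linear (pairing Z : 'cV[R]_n -> R) by move=> t u v; exact: pairing_linearr.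
pose L : {linear 'cV[R]_n -> R} :=
  HB.pack (pairing Z : 'cV[R]_n -> R) (GRing.isLinear.Build R 'cV[R]_n R _ _ lZ).
have cL : continuous L.
  rewrite (_ : (L : 'cV[R]_n -> R) =
      \sum_k (Z 0 k *: (fun a : 'cV[R]_n => a k 0 : R))); last first.
    by apply/funext => a; rewrite fct_sumE /= /pairing mxE.
  move=> a; apply: differentiable_continuous; apply: differentiable_sum => k.
  by apply: differentiableZ; exact: differentiable_coord.
have dL a : differentiable L a by exact: linear_differentiable.
rewrite (derive_comp (g := L) h db erefl (dL _)).
by rewrite [RHS]deriveE// diff_lin.
Qed.

Lemma pairing_sumr Z (b : 'I_n -> R) : pairing Z (\col_k b k) = \sum_k Z 0 k * b k.
Proof. by rewrite /pairing mxE; apply: eq_bigr => k _; rewrite mxE. Qed.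

Lemma pairing_suml (I : finType) (c : I -> R) (X : I -> E) (a : 'cV[R]_n) :
  \sum_k c k * pairing (X k) a = pairing (\sum_k c k *: X k) a.
Proof.
rewrite /pairing mulmx_suml summxE; apply: eq_bigr => k _.
by rewrite -scalemxAl [RHS]mxE.
Qed.

Lemma pairing_sumrr (I : finType) (c : I -> R) (X : E) (a : I -> 'cV[R]_n) :
  \sum_k c k * pairing X (a k) = pairing X (\sum_k c k *: a k).
Proof.
rewrite /pairing mulmx_sumr summxE; apply: eq_bigr => k _.
by rewrite -scalemxAr [RHS]mxE.
Qed.

(** Paired with a constant [Z], and with the covector parts replaced by contractions of [B], the
    bracket yields derivatives of [B], which add up to dB(X, Y, Z) = 0, and derivatives of X and Y.
    Of the latter, the two containing ['D_Z X] cancel by antisymmetry and the rest is B([X, Y],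
    Z). *)
Lemma dorfman_in_graph (B : E -> preform) (e1 e2 : E -> gfiber) y0 (N : set E) :
  open N -> N y0 -> (forall z, N z -> alternating_form (B z)) ->
  (forall j k, differentiable
    (fun z => B z [:: basis_vector j; basis_vector k] : R) y0) ->
  closed_at B y0 ->
  differentiable (fun y => (e1 y).1) y0 -> differentiable (fun y => (e1 y).2) y0 ->
  differentiable (fun y => (e2 y).1) y0 -> differentiable (fun y => (e2 y).2) y0 ->
  (forall y, N y -> in_graph (B y) (e1 y)) ->
  (forall y, N y -> in_graph (B y) (e2 y)) ->
  in_graph (B y0) (dorfman_coords e1 e2 y0).
Proof.
move=> oN N0 aB dB clB dX da dY db g1 g2 Z.
have mB z : N z -> multilinear (B z) by move=> /aB[].
have nN : \forall y \near y0, N y by exact: open_nbhs_nbhs.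
(* [derive_bilinear] with the identity as [phi] and a constant second slot, whose derivative
   contributes nothing. *)
have DB h (P : E -> E) (W : E) : differentiable P y0 ->
    'D_h (fun y => B y [:: P y; W]) y0 =
    'D_h (fun y => B y [:: P y0; W]) y0 + B y0 [:: 'D_h P y0; W].
  move=> dP; have did : differentiable (id : E -> E) y0 by exact: ex_diff.
  have dW : differentiable (cst W : E -> E) y0 by exact: differentiable_cst.
  rewrite (derive_bilinear h oN (N0 : N (id y0)) mB dB did dP dW).
  rewrite derive_id derive_cst [X in _ + X](_ : _ = 0) ?addr0//.
  have [_ /(_ [:: P y0] [::])] := aB _ N0.
  rewrite /cst -[0 : E](scale0r (0 : E)) => _.
  have := mB _ N0 [:: P y0] [::] (-1) 0 0.
  by rewrite /= scaler0 addr0 scale0r => ->; rewrite mulN1r addNr.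
have Da h W : 'D_h (fun y => pairing W (e1 y).2) y0 =
    'D_h (fun y => B y [:: (e1 y).1; W]) y0.
  by apply: near_eq_derive; apply: filterS nN => y Ny; exact: g1.
have Db h W : 'D_h (fun y => pairing W (e2 y).2) y0 =
    'D_h (fun y => B y [:: (e2 y).1; W]) y0.
  by apply: near_eq_derive; apply: filterS nN => y Ny; exact: g2.
rewrite /dorfman_coords /lie_derivative /contract_d /lie_bracket /=.
set X := fun z => (e1 z).1; set Y := fun z => (e2 z).1.
set a := fun z => (e1 z).2; set b := fun z => (e2 z).2.
have pD (u v : 'cV[R]_n) : pairing Z (u + v) = pairing Z u + pairing Z v.
  by rewrite -{1}[u]scale1r pairing_linearr mul1r.
have pB (u v : 'cV[R]_n) : pairing Z (u - v) = pairing Z u - pairing Z v.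
  by rewrite pD; congr +%R; rewrite /pairing mulmxN mxE.
have T1 : pairing Z ('D_(X y0) b y0) =
    'D_(X y0) (fun y => B y [:: Y y0; Z]) y0 + B y0 [:: 'D_(X y0) Y y0; Z].
  by apply: etrans (pairing_derive _ _ db) _; apply: etrans (Db _ _) (DB _ Y _ dY).
have T3 : pairing Z ('D_(Y y0) a y0) =
    'D_(Y y0) (fun y => B y [:: X y0; Z]) y0 + B y0 [:: 'D_(Y y0) X y0; Z].
  by apply: etrans (pairing_derive _ _ da) _; apply: etrans (Da _ _) (DB _ X _ dX).
have T2 : pairing Z (\col_k pairing ('D_(basis_vector k) X y0) (b y0)) =
    B y0 [:: Y y0; 'D_Z X y0].
  by rewrite pairing_sumr pairing_suml -(diff_rV Z dX); exact: g2.
have T4 : pairing Z (\col_k pairing (Y y0) ('D_(basis_vector k) a y0)) =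
    'D_Z (fun y => B y [:: X y0; Y y0]) y0 + B y0 [:: 'D_Z X y0; Y y0].
  rewrite pairing_sumr pairing_sumrr -(diff_rV Z da).
  by apply: etrans (pairing_derive _ _ da) _; apply: etrans (Da _ _) (DB _ X _ dX).
rewrite pB pD pB T1 T2 T3 T4.
have := mB _ N0 [::] [:: Z] (-1) ('D_(Y y0) X y0) ('D_(X y0) Y y0).
rewrite /= scaleN1r addrC mulN1r => ->.
have [mB0 nB0] := (alternatingP _).1 (aB _ N0).
rewrite (multilinear_swap (Y y0) ('D_Z X y0) [::] mB0 nB0).
have := clB (X y0) (Y y0) Z.
move: ('D_(X y0) (fun y => B y [:: Y y0; Z] : R) y0)
  ('D_(Y y0) (fun y => B y [:: X y0; Z] : R) y0)
  ('D_Z (fun y => B y [:: X y0; Y y0] : R) y0).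
move: (B y0 [:: 'D_(X y0) Y y0; Z]) (B y0 [:: 'D_(Y y0) X y0; Z])
  (B y0 [:: 'D_Z X y0; Y y0]) => x1 x2 x3 d1 d2 d3 h.
lra.
Qed.

End DifferentiateForms.

(** * Closedness under changes of coordinates *)

Section ClosedPullback.
Context {R : realType} {n : nat}.
Local Notation E := 'rV[R]_n.

Lemma derive_comm_row (U : set E) (phi : E -> E) y u v : open U ->
  smooth_on U phi -> U y ->
  'D_u (fun y => 'D_v phi y) y = 'D_v (fun y => 'D_u phi y) y.
Proof.
move=> oU sphi Uy.
have dphi z : U z -> differentiable phi z by exact: smooth_on_differentiable sphi.
have D v' u' j : 'D_u' (fun y => 'D_v' phi y) y 0 j =
    'D_u' (fun y => 'D_v' (fun y => phi y 0 j : R) y) y.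
  rewrite -derive_coord; last first.
    by apply: (@smooth_on_differentiable _ _ _ U) => //; exact: smooth_on_derive.
  apply: near_eq_derive; have := open_nbhs_nbhs (conj oU Uy).
  by apply: filterS => z Uz; rewrite derive_coord//; exact: dphi.
apply/rowP => j; apply: etrans (D v u j) _; apply: etrans _ (esym (D u v j)).
by apply: (derive_comm _ _ oU _ Uy); exact: smooth_on_coord.
Qed.

(** Pullback commutes with d: the derivatives of [B] give dB on the images of [u], [v], [z], while
    the terms with second derivatives of [phi] cancel in pairs, these being symmetric and [B]
    skew. *)
Lemma closed_at_pullback (B B' : E -> preform) (phi : E -> E) y0 (U N : set E) :
  open U -> U y0 -> smooth_on U phi -> open N -> N (phi y0) ->
  (forall z, N z -> alternating_form (B z)) ->
  (forall j k, differentiable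
    (fun z => B z [:: basis_vector j; basis_vector k] : R) (phi y0)) ->
  (forall y u v, U y -> B' y [:: u; v] = B (phi y) [:: 'D_u phi y; 'D_v phi y]) ->
  closed_at B (phi y0) -> closed_at B' y0.
Proof.
move=> oU U0 sphi oN N0 aB dB B'E cB u v z.
have mB y : N y -> multilinear (B y) by move=> /aB[].
have dphi : differentiable phi y0 by exact: smooth_on_differentiable sphi U0.
have dD h : differentiable (fun y => 'D_h phi y) y0.
  by apply: (@smooth_on_differentiable _ _ _ U) => //; exact: smooth_on_derive.
(* [d] is the second and [P] the first derivative of [phi] at [y0]; behind the existential only the
   symmetry of [d] and the Leibniz rule remain visible. *)
have [d [P [dC F]]] : exists (d : E -> E -> E) (P : E -> E),
    (forall p q, d p q = d q p) /\
    forall h p q, 'D_h (fun y => B' y [:: p; q] : R) y0 =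
      'D_(P h) (fun z => B z [:: P p; P q] : R) (phi y0) +
      B (phi y0) [:: d h p; P q] + B (phi y0) [:: P p; d h q].
  exists (fun p q => 'D_p (fun y => 'D_q phi y) y0), (fun p => 'D_p phi y0).
  split=> [p q|h p q]; first exact: derive_comm_row sphi U0.
  apply: etrans _ (derive_bilinear h oN N0 mB dB dphi (dD p) (dD q)).
  apply: near_eq_derive; have := open_nbhs_nbhs (conj oU U0).
  by apply: filterS => y Uy; exact: B'E.
rewrite (F u v z) (F v u z) (F z u v) (dC v u) (dC z u) (dC z v) => {F}.
have [mB0 nB0] := (alternatingP _).1 (aB _ N0).
rewrite (multilinear_swap (d u z) (P v) [::] mB0 nB0).
have := cB (P u) (P v) (P z).
move: ('D_(P u) (fun y => B y [:: P v; P z] : R) (phi y0)).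
move: ('D_(P v) (fun y => B y [:: P u; P z] : R) (phi y0)).
move: ('D_(P z) (fun y => B y [:: P u; P v] : R) (phi y0)).
move: (B (phi y0) [:: d u v; P z]) (B (phi y0) [:: P v; d u z])
  (B (phi y0) [:: P u; d v z]) => x1 x2 x3 d1 d2 d3 h.
lra.
Qed.

End ClosedPullback.

Section ClosedCharts.
Context {R : realType} {n : nat} {M : topologicalType}.
Context {A : smooth_manifold R n M}.
Implicit Types (i c : chart_index A) (x : M) (W : set M) (w : M -> @preform R n).

Definition local_form i w (y : 'rV[R]_n) : @preform R n :=
  fcoord i (chart_inv i y) (w (chart_inv i y)).

Lemma local_form_smooth W w i s : open W -> differential_form A W w ->
  smooth_on (chart i @` (W `&` chart_dom i)) (fun y => local_form i w y s).
Proof.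
move=> oW [_ /(_ i s)]; apply: smooth_on_eq; first exact: chart_image_open.
by move=> y _; rewrite form_coordsE.
Qed.

Lemma local_form_alternating W w i y : differential_form A W w ->
  (chart i @` (W `&` chart_dom i)) y -> alternating_form (local_form i w y).
Proof.
move=> [aw _] [x [Wx ix] <-]; rewrite /local_form chartK//.
exact: pullback_alternating (aw _ Wx).
Qed.

Lemma local_form_differentiable W w i x s : open W -> differential_form A W w ->
  W x -> chart_dom i x -> differentiable (fun y => local_form i w y s : R) (chart i x).
Proof.
move=> oW dw Wx ix; apply: smooth_on_differentiable (local_form_smooth i s oW dw) _.
by exists x.
Qed.

(** [closed_form] tests each point in its own preferred chart; pulling back by the transition map
    gives closedness in a fixed chart. *)
Lemma closed_at_chart W w i x : open W -> differential_form A W w ->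
  closed_form A W w -> W x -> chart_dom i x -> closed_at (local_form i w) (chart i x).
Proof.
move=> oW dw cw Wx ix; pose c := chart_at A x; have cx : chart_dom c x := chart_at_dom A x.
have cc : closed_at (local_form c w) (chart c x).
  move=> u v z; have := cw x Wx [:: u; v; z].
  have E s : (fun y => form_coords c w y s : R) = fun y => local_form c w y s.
    by apply/funext => y; rewrite form_coordsE.
  rewrite /exterior_derivative /= !big_ord_recl big_ord0 /= -/c !E /bump /=.
  by rewrite expr0 expr1 mul1r mulN1r sqrrN expr1n mul1r addr0 addrA.
have tE : (chart c \o chart_inv i) (chart i x) = chart c x by rewrite /= chartK.
have oWc : open (W `&` chart_dom c) by apply: openI => //; exact: chart_dom_open.
apply: (@closed_at_pullback _ _ (local_form c w) _ (chart c \o chart_inv i) _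
  (chart i @` ((W `&` chart_dom c) `&` chart_dom i))
  (chart c @` (W `&` chart_dom c))); rewrite ?tE//.
- exact: chart_image_open.
- by exists x.
- apply: smooth_on_sub (@transition_smooth _ _ _ _ i c).
  by move=> _ [y [[_ ?] ?] <-]; exists y.
- exact: chart_image_open.
- by exists x.
- by move=> y; exact: local_form_alternating.
- by move=> j k; exact: local_form_differentiable Wx cx.
- move=> _ u v [y [[Wy cy] iy] <-].
  by rewrite /local_form /= !chartK// (fcoord_transition _ _ cy iy) /pullback /= !mul_jac.
Qed.

End ClosedCharts.

(** * Closure of the graph *)

Section Closure.
Context {R : realType} {n : nat} {M : topologicalType}.
Context {A : smooth_manifold R n M}.
Implicit Types (i j c : chart_index A) (x : M) (W : set M).

Lemma open_chart_neq0 (N : set M) c (g : 'rV[R]_n -> R) : open N ->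
  (forall x, N x -> chart_dom c x -> {for chart c x, continuous g}) ->
  open [set x | [/\ N x, chart_dom c x & g (chart c x) != 0]].
Proof.
move=> oN cg; rewrite openE => x [Nx cx gx].
have n1 : \forall z \near x, N z by exact: open_nbhs_nbhs.
have n2 : \forall z \near x, chart_dom c z.
  exact: open_nbhs_nbhs (conj (@chart_dom_open _ _ _ A c) cx).
have n3 : \forall z \near x, g (chart c z) != 0.
  have cgc := continuous_comp (chart_continuous cx) (cg x Nx cx).
  by apply: (cgc [set z : R | z != 0]); apply: open_nbhs_nbhs; split=> //.
apply: filterS3 n1 n2 n3 => z Nz cz gz; split=> //.
Qed.

Context (Msing : set M).
Context (Msing_dense : dense (~` Msing)).
Context (w : M -> @preform R n).

(** The type [gtangent] does not record the atlas on which its topology depends; naming the instance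
    fixes [A]. *)
Local Notation TT := (Defs_gtangent__canonical__topology_structure_Topological A).
Local Notation L := (@closure TT (graph (~` Msing) w)).

Lemma graphP x u : ~ Msing x -> in_graph (w x) u -> L (x, u).
Proof. by move=> sx gu; apply: subset_closure; split. Qed.

Lemma closure_graph_coords W i x (g : 'rV[R]_n -> @gfiber R n) : open W -> W x ->
  chart_dom i x -> {for chart i x, continuous g} ->
  (forall x, W x -> chart_dom i x -> ~ Msing x ->
    in_graph (local_form i w (chart i x)) (g (chart i x))) ->
  L (x, ofcoord i x (g (chart i x))).
Proof.
move=> oW Wx ix cg gg B; rewrite nbhsE => -[Q [oQ Qx] QB].
have /(_ i) oQi : @gtangent_open R n M A Q by exact: oQ.
set Qi := [set p | _] in oQi.
have Qi0 : Qi (chart i x, g (chart i x)).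
  split; first by exists x.
  by rewrite of_coordsE /= chartK.
have n1 : \forall z \near x, W z by exact: open_nbhs_nbhs.
have n2 : \forall z \near x, chart_dom i z.
  exact: open_nbhs_nbhs (conj (@chart_dom_open _ _ _ A i) ix).
have n3 : \forall z \near x, Qi (chart i z, g (chart i z)).
  have cgi : (chart i z, g (chart i z)) @[z --> x] --> (chart i x, g (chart i x)).
    have h1 : chart i z @[z --> x] --> chart i x := chart_continuous ix.
    have h2 : g (chart i z) @[z --> x] --> g (chart i x) :=
      continuous_comp (chart_continuous ix) cg.
    exact: (cvg_pair h1 h2).
  by apply: (cgi Qi); exact: open_nbhs_nbhs.
have : \forall z \near x, W z /\ chart_dom i z /\ Qi (chart i z, g (chart i z)).
  by apply: filterS3 n1 n2 n3 => z Wz iz Qz.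
rewrite /prop_near1 nbhsE => -[P [oP Px] PP].
have [|z [/PP[Wz [iz [_ Qz]]] sz]] := Msing_dense _ oP; first by exists x.
have gz : in_graph (w z) (ofcoord i z (g (chart i z))).
  apply/(in_graph_coord _ _ iz); rewrite ofcoordK//.
  by have := gg z Wz iz sz; rewrite /local_form chartK.
exists (z, ofcoord i z (g (chart i z))); split; first by split.
by apply: QB; move: Qz; rewrite of_coordsE /= chartK.
Qed.

Lemma smooth_isotropic_pairing (V : normedModType R) (U : set V)
    (f g : V -> @gfiber R n) : open U -> smooth_on U f -> smooth_on U g ->
  smooth_on U (fun y => isotropic_pairing (f y) (g y)).
Proof.
move=> oU sf sg.
have sp (f' g' : V -> @gfiber R n) : smooth_on U f' -> smooth_on U g' ->
    smooth_on U (fun y => pairing (f' y).1 (g' y).2).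
  move=> sf' sg'; apply: (@smooth_on_eq _ _ _ _
    (fun y => \sum_k (f' y).1 0 k * (g' y).2 k 0)) => //.
    by move=> y _; rewrite /pairing mxE.
  apply: smooth_on_sum => // k; apply: smooth_onM => //; apply: smooth_on_coord => //.
    exact: smooth_on_fst.
  exact: smooth_on_snd.
apply: smooth_onM => //; first exact: smooth_on_cst.
by apply: smooth_onD => //; exact: sp.
Qed.

(** Failing to be orthogonal to the smooth section [e] is an open condition on the total space, so a
    point of the closure satisfying it would force a graph vector to satisfy it. *)
Lemma closure_orthogonal W (e : M -> @gfiber R n) x u : open W ->
  smooth_section A W e ->
  (forall x u, W x -> ~ Msing x -> in_graph (w x) u ->
    isotropic_pairing u (e x) = 0) ->
  W x -> L (x, u) -> isotropic_pairing u (e x) = 0.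
Proof.
move=> oW se orth Wx Lu; apply/eqP/negP => /negP ux.
pose Q : set (@gtangent R n M) :=
  [set p | W p.1 /\ isotropic_pairing p.2 (e p.1) != 0].
have oQ : @gtangent_open R n M A Q.
  move=> j; pose U : set ('rV[R]_n * @gfiber R n) :=
    fst @^-1` (chart j @` (W `&` chart_dom j)).
  have oU : open U.
    apply: open_comp => [p _|]; [exact: cvg_fst|exact: chart_image_open].
  (* The pairing in coordinates of chart [j], smooth in base point and fibre; by invariance of the
     pairing, [Q] is its nonvanishing set there. *)
  pose h (p : 'rV[R]_n * @gfiber R n) :=
    isotropic_pairing p.2 (section_coords j e p.1).
  have sfst : smooth_on U (fst : 'rV[R]_n * @gfiber R n -> 'rV[R]_n).
    apply: (smooth_on_linear (L := fst : {linear ('rV[R]_n * @gfiber R n)%type -> 'rV[R]_n})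
      (f := fun p => p)) => //; last exact: smooth_on_id.
    by move=> p; exact: cvg_fst.
  have ssnd : smooth_on U (snd : 'rV[R]_n * @gfiber R n -> @gfiber R n).
    apply: (smooth_on_linear (L := snd : {linear ('rV[R]_n * @gfiber R n)%type -> @gfiber R n})
      (f := fun p => p)) => //; last exact: smooth_on_id.
    by move=> p; exact: cvg_snd.
  have oi := chart_image_open (i := j) oW.
  have sh : smooth_on U h.
    apply: smooth_isotropic_pairing => //.
    apply: smooth_on_gfiber => // k l.
      apply: (smooth_on_comp (f := fst) (g := fun y => (section_coords j e y).1 k l) oU oi) => //.
      by apply: smooth_on_coord => //; exact: smooth_on_fst (se j).
    apply: (smooth_on_comp (f := fst) (g := fun y => (section_coords j e y).2 k l) oU oi) => //.
    by apply: smooth_on_coord => //; exact: smooth_on_snd (se j).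
  have hE y jy : W y -> chart_dom j y -> h (chart j y, jy) =
      isotropic_pairing (ofcoord j y jy) (e y).
    move=> Wy dy; rewrite /h /= section_coordsE chartK//.
    by rewrite -[in LHS](ofcoordK dy jy) isotropic_pairing_tocoord.
  rewrite (_ : [set p | _] = [set p | U p /\ h p != 0]); last first.
    apply/seteqP; split=> -[y v] /=.
      case=> -[z dz /= <-]; rewrite of_coordsE /Q /= chartK// => -[Wz].
      by rewrite -hE// => ?; split=> //; exists z.
    case=> -[z [Wz dz] /= <-]; rewrite hE// => hz; split; first by exists z.
    by rewrite of_coordsE /Q /= chartK.
  rewrite openE => p [Up hp].
  have n1 : \forall q \near p, U q by exact: open_nbhs_nbhs.
  have n2 : \forall q \near p, h q != 0.
    have ch := smooth_on_continuous sh Up.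
    by apply: (ch [set z : R | z != 0]); apply: open_nbhs_nbhs; split=> //.
  by apply: filterS2 n1 n2 => q Uq hq; split.
have : @nbhs _ TT (x, u) Q by apply: (@open_nbhs_nbhs TT); split.
move=> /Lu[[z v] [[/= sz gv] [/= Wz /eqP]]]; apply.
exact: orth.
Qed.

End Closure.

(** * The two implications *)

Section Removability.
Context {R : realType} {n : nat} {M : topologicalType}.
Context {A : smooth_manifold R n M}.
Context (Msing : set M) (Msing_closed : closed Msing).
Context (Msing_dense : dense (~` Msing)).
Context (w : M -> @preform R n).
Context (w_2form : differential_kform A 2 (~` Msing) w).
Local Notation TT := (Defs_gtangent__canonical__topology_structure_Topological A).
Local Notation L := (@closure TT (graph (~` Msing) w)).
Local Notation bv := (@basis_vector R n).

Lemma regular_alternating x : ~ Msing x -> alternating_form (w x).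
Proof. by case: w_2form => -[h _] _; exact: h. Qed.

Lemma regular_homogeneous x : ~ Msing x -> homogeneous 2 (w x).
Proof. by case: w_2form => _; exact. Qed.

(** * From a nonvanishing spinor to a Dirac structure *)

Section SpinorToDirac.
Context (w_closed : closed_form A (~` Msing) w).
Context (U : set M) (f : M -> R) (rho : M -> @preform R n) (m : M).
Context (oU : open U) (Um : U m) (rho_form : differential_form A U rho).
Context (rhoE : forall x, U x -> ~ Msing x ->
  forall s, rho x s = f x * exp_neg (w x) s).
Context (rho_neq0 : exists s, rho m s != 0).

Let c := chart_at A m.
Let cm : chart_dom c m := chart_at_dom A m.
Let r := local_form c rho.

Lemma exists_leading_index : exists t0, r (chart c m) (map bv t0) != 0.
Proof.
have [s sm] := rho_neq0; apply/not_existsP => h; move/eqP: sm; apply.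
have arm : alternating_form (r (chart c m)).
  by apply: local_form_alternating rho_form _; exists m.
rewrite -(fcoordK (rho m) s cm) /pullback.
rewrite -[fcoord c m (rho m)](_ : r (chart c m) = _); last first.
  by rewrite /r /local_form chartK.
rewrite mlextE; last by case: arm.
by apply: mlext0 => t _; apply/eqP/negP => /negP; exact: h.
Qed.

Context (t0 : seq 'I_n) (t0m : r (chart c m) (map bv t0) != 0).

Let W := [set x | [/\ U x, chart_dom c x & r (chart c x) (map bv t0) != 0]].

Let r_smooth t : smooth_on (chart c @` (U `&` chart_dom c)) (fun y => r y (map bv t)).
Proof. exact: local_form_smooth. Qed.

Lemma leading_open : open W.
Proof.
apply: (open_chart_neq0 (g := fun y => r y (map bv t0))) => // x Ux cx.
apply: smooth_on_continuous (r_smooth t0) _.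
by exists x.
Qed.
Let oW := leading_open.
Let Wc : W `<=` chart_dom c. Proof. by move=> x []. Qed.
Let V := chart c @` (W `&` chart_dom c).
Let oV : open V. Proof. exact: chart_image_open. Qed.
Let VU : V `<=` chart c @` (U `&` chart_dom c).
Proof. by move=> _ [x [[Ux _ _] cx] <-]; exists x. Qed.

Let F i y := normal_frame t0 (r y) i.
Let e i x := ofcoord c x (F i (chart c x)).

Lemma frame_smooth i : smooth_on V (F i).
Proof.
have [s1 s2] : smooth_mx V (fun y => (F i y).1) /\ smooth_mx V (fun y => (F i y).2).
  apply: smooth_normal_frame => //.
  - by move=> y Vy; apply: local_form_alternating rho_form (VU Vy).
  - by move=> t; exact: smooth_on_sub VU (r_smooth t).
  - by move=> _ [x [[_ _ rx] _] <-].
exact: smooth_on_gfiber.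
Qed.

Lemma frame_smooth_section i : smooth_section A W (e i).
Proof.
apply: (smooth_section_chart (c := c)) => //.
apply: smooth_on_eq (frame_smooth i) => // y; rewrite inE => -[x [Wx cx] <-].
by rewrite /e chartK// ofcoordK.
Qed.

(** The nonzero component along [t0] forces [f x] to be nonzero, so [rho x] and e^{-w} have the same
    annihilator at [x]. *)
Lemma frame_in_graph i x : W x -> ~ Msing x ->
  in_graph (fcoord c x (w x)) (F i (chart c x)).
Proof.
move=> [Ux cx rx] sx.
have rE : r (chart c x) = fun s => f x * exp_neg (fcoord c x (w x)) s.
  apply/funext => s; rewrite /r /local_form chartK// /fcoord -pullback_exp_neg.
  by rewrite /pullback rhoE.
rewrite /F rE; apply: in_graph_normal_frame.
- exact: pullback_alternating (regular_alternating sx).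
- exact: pullback_homogeneous (regular_homogeneous sx).
- by have := rx; rewrite rE.
Qed.

Lemma frame_section_in_graph i x : W x -> ~ Msing x -> in_graph (w x) (e i x).
Proof.
move=> Wx sx; have cx := Wc Wx; apply/(in_graph_coord _ _ cx).
by rewrite /e ofcoordK//; exact: frame_in_graph.
Qed.

Lemma frame_isotropic i j x : W x ->
  isotropic_pairing (F i (chart c x)) (F j (chart c x)) = 0.
Proof.
move=> Wx; have cx := Wc Wx.
apply: (@dense_chart_eq _ _ _ A _ c W x
  (fun y => isotropic_pairing (F i y) (F j y)) Msing_dense oW Wx cx).
  apply: (@smooth_on_continuous _ _ _ V); last by exists x.
  by apply: smooth_isotropic_pairing => //; exact: frame_smooth.
move=> z Wz cz sz; apply: (in_graph_isotropic (w := fcoord c z (w z))).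
- exact: pullback_alternating (regular_alternating sz).
- exact: frame_in_graph.
- exact: frame_in_graph.
Qed.

Lemma orthogonal_frame x u : W x -> (forall i, isotropic_pairing u (e i x) = 0) ->
  exists a : 'I_n -> R, u = \sum_i a i *: e i x.
Proof.
move=> Wx h; have cx := Wc Wx.
exists (fun i => coefs t0 (tocoord c x u) 0 i).
apply: (can_inj (tocoordK cx)); rewrite linear_sum.
under eq_bigr do rewrite linearZ /= /e ofcoordK//.
apply: orthogonal_normal_span.
- by move=> i; exact: coefs_normal_frame.
- by move=> i j; exact: frame_isotropic.
- by move=> i; rewrite -(h i) -[RHS](isotropic_pairing_tocoord _ _ cx) /e ofcoordK.
Qed.

(** A limit of graph vectors is orthogonal to the frame, hence in its span; conversely a combination
    with constant coefficients is a continuous section that lies in the graph at regular points. *)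
Lemma closure_fiber x u : W x ->
  L (x, u) <-> exists a : 'I_n -> R, u = \sum_i a i *: e i x.
Proof.
move=> Wx; have cx := Wc Wx; split=> [Lu|[a ->]].
  apply: orthogonal_frame => // i.
  apply: (closure_orthogonal oW (frame_smooth_section i) _ Wx Lu).
  move=> z v Wz sz gv.
  apply: (in_graph_isotropic (regular_alternating sz)) => //.
  exact: frame_section_in_graph.
have -> : \sum_i a i *: e i x =
    ofcoord c x ((fun y => \sum_i a i *: F i y) (chart c x)).
  by rewrite linear_sum; apply: eq_bigr => i _; rewrite linearZ.
apply: (closure_graph_coords Msing_dense (g := fun y => \sum_i a i *: F i y)
  oW Wx cx).
  apply: (@smooth_on_continuous _ _ _ V); last by exists x.
  apply: smooth_on_sum => // i k.
  have -> : (fun y => a i *: F i y) = ( *:%R (a i) \o F i) by [].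
  apply: Ck_on_linear => //; last exact: frame_smooth.
  exact: scaler_continuous.
move=> z Wz cz sz; rewrite /local_form chartK//.
apply: in_graph_sum; last by move=> i; exact: frame_in_graph.
by case: (pullback_alternating (cjac c (chart_at A z) z) (regular_alternating sz)).
Qed.

Lemma closure_dirac : dirac_structure A W L.
Proof.
split.
- move=> x Wx; exists W; split=> //; exists n, e; split.
  + by move=> k; exact: frame_smooth_section.
  + move=> y Wy a a0 k; have cy := Wc Wy.
    have : coefs t0 (tocoord c y (\sum_k a k *: e k y)) 0 k = a k.
      rewrite !linear_sum summxE (bigD1 k)//= big1 ?addr0.
        by rewrite !linearZ /= /e ofcoordK// coefs_normal_frame !mxE !eqxx mulr1.
      move=> j jk; rewrite !linearZ /= /e ofcoordK// coefs_normal_frame !mxE.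
      by rewrite [k == j]eq_sym (negbTE jk) andbF mulr0.
    by rewrite a0 !linear0 mxE => <-.
  + by move=> y Wy; apply/seteqP; split=> u /(closure_fiber _ Wy).
- move=> x Wx; have cx := Wc Wx; split.
    split.
      split.
        by apply/(closure_fiber _ Wx); exists (fun=> 0); rewrite big1// => i _; rewrite scale0r.
      move=> t u v /(closure_fiber _ Wx)[a ->] /(closure_fiber _ Wx)[b ->].
      apply/(closure_fiber _ Wx); exists (fun i => t * a i + b i).
      rewrite scaler_sumr -big_split; apply: eq_bigr => i _ /=.
      by rewrite scalerDl scalerA.
    move=> u v /(closure_fiber _ Wx)[a ->] /(closure_fiber _ Wx)[b ->].
    apply: isotropic_pairing_sumr => i; rewrite isotropic_pairingC.
    apply: isotropic_pairing_sumr => j; rewrite iso_ofcoord//; exact: frame_isotropic.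
  (* Maximality: an isotropic [N'] containing the fibre is orthogonal to the frame, hence inside its
     span. *)
  move=> N' [_ iN'] LN'; apply/seteqP; split=> // u N'u.
  apply/(closure_fiber _ Wx); apply: orthogonal_frame => // i.
  apply: iN' => //; apply: LN'; apply/(closure_fiber _ Wx).
  exists (fun j => (j == i)%:R); rewrite (bigD1 i)//= eqxx scale1r big1 ?addr0//.
  by move=> j /negbTE ->; rewrite scale0r.
(* Chart [i] instead of [c], because [dorfman] at [x] is computed in the preferred chart of [x],
   where [ofcoord] is the identity. *)
- move=> e1 e2 [s1 L1] [s2 L2] x Wx; pose i := chart_at A x.
  have ix : chart_dom i x := chart_at_dom A x.
  pose E1 := section_coords i e1; pose E2 := section_coords i e2.
  pose Vi := chart i @` (W `&` chart_dom i).
  have oVi : open Vi by exact: chart_image_open.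
  have -> : dorfman A e1 e2 x = ofcoord i x (dorfman_coords E1 E2 (chart i x)).
    rewrite /ofcoord -/i jac_id// mulmx1 mul1mx.
    by rewrite /dorfman; case: (dorfman_coords _ _ _).
  (* Involutivity as a limit: the bracket is smooth in the chart, and at regular points it lies in
     the graph. *)
  apply: (closure_graph_coords Msing_dense (g := dorfman_coords E1 E2) oW Wx ix).
    apply: (smooth_on_continuous (U := Vi)); last by exists x.
    by apply: smooth_dorfman => //; [exact: s1|exact: s2].
  move=> z Wz iz sz.
  pose N := chart i @` ((W `&` ~` Msing) `&` chart_dom i).
  have oR : open (~` Msing) by exact: closed_openC.
  have oN : open N by apply: chart_image_open; exact: openI.
  have Nz : N (chart i z) by exists z.
  have NV : N `<=` Vi by move=> _ [y [[? ?] ?] <-]; exists y.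
  have gE ek y : section_of A W L ek -> N y -> in_graph (local_form i w y) (section_coords i ek y).
    move=> [_ Lk] [q [[Wq sq] iq] <-]; rewrite section_coordsE /local_form chartK//.
    apply/(in_graph_coord _ _ iq) => //.
    have /(closure_fiber _ Wq)[a ->] := Lk q Wq.
    apply: in_graph_sum; last by move=> k; exact: frame_section_in_graph.
    by case: (regular_alternating sq).
  have [dw _] := w_2form.
  have dE (ek : M -> @gfiber R n) : smooth_section A W ek ->
      differentiable (fun y => (section_coords i ek y).1) (chart i z) /\
      differentiable (fun y => (section_coords i ek y).2) (chart i z).
    move=> sk; have Vz := NV _ Nz; split.
      exact: smooth_on_differentiable (smooth_on_fst oVi (sk i)) Vz.
    exact: smooth_on_differentiable (smooth_on_snd oVi (sk i)) Vz.
  have [dX da] := dE _ s1; have [dY db] := dE _ s2.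
  apply: (dorfman_in_graph oN Nz) => //.
  + move=> _ [y [[Wy sy] iy] <-]; apply: local_form_alternating dw _.
    by exists y.
  + by move=> j k; exact: (local_form_differentiable _ oR dw sz iz).
  + exact: (closed_at_chart oR dw w_closed sz iz).
  + by move=> y; exact: gE.
  + by move=> y; exact: gE.
Qed.

End SpinorToDirac.
End Removability.

(** * From a Dirac structure to an extended spinor *)

Section DiracToSpinor.
Context {R : realType} {n : nat} {M : topologicalType}.
Context {A : smooth_manifold R n M}.
Context (Msing : set M) (Msing_closed : closed Msing).
Context (Msing_dense : dense (~` Msing)).
Context (w : M -> @preform R n).
Context (w_2form : differential_kform A 2 (~` Msing) w).
Local Notation TT := (Defs_gtangent__canonical__topology_structure_Topological A).
Local Notation L := (@closure TT (graph (~` Msing) w)).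
Local Notation bv := (@basis_vector R n).

Let altw x : ~ Msing x -> alternating_form (w x).
Proof. exact: regular_alternating w_2form x. Qed.
Let homw x : ~ Msing x -> homogeneous 2 (w x).
Proof. exact: regular_homogeneous w_2form x. Qed.

(** A vector orthogonal to the whole graph of [w x] belongs to it. So over a regular point the
    closure adds nothing once its fibre is isotropic. *)
Lemma isotropic_fiber_regular x u : isotropic (fiber_of L x) -> ~ Msing x ->
  L (x, u) <-> in_graph (w x) u.
Proof.
move=> [_ iso] sx; have [mw nw] := (alternatingP _).1 (altw sx).
split; last exact: graphP.
move=> Lu Y; have gY := graph_vectorP Y mw.
have /eqP := iso u (graph_vector (w x) Y) Lu (graphP sx gY).
rewrite /isotropic_pairing mulf_eq0 invr_eq0 pnatr_eq0 /= gY /=.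
rewrite (multilinear_swap _ _ _ mw nw) => /eqP; rewrite addrC.
by move/eqP; rewrite subr_eq0 => /eqP.
Qed.

(** A graph projects bijectively to the tangent space, so the vector parts of the frame form a basis
    there. This fixes the rank, which [smooth_subbundle] leaves open. *)
Lemma frame_rank r (e : 'I_r -> @gfiber R n) (a : @preform R n) :
  alternating_form a ->
  (forall c : 'I_r -> R, \sum_k c k *: e k = 0 -> forall k, c k = 0) ->
  (forall u, in_graph a u <-> exists c : 'I_r -> R, u = \sum_k c k *: e k) ->
  r = n.
Proof.
move=> aa free span; have ma : multilinear a by case: aa.
pose X : 'M[R]_(r, n) := \matrix_(k, j) (e k).1 0 j.
have XE (v : 'rV[R]_r) : v *m X = (\sum_k v 0 k *: e k).1.
  rewrite (raddf_sum (fst : {linear gfiber -> 'rV[R]_n})) mulmx_sum_row.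
  by apply: eq_bigr => k _ /=; congr (_ *: _); apply/rowP => j; rewrite !mxE.
have Xfree : row_free X.
  rewrite -kermx_eq0; apply/eqP/row_matrixP => k; rewrite row0.
  set v := row k _; have v0 : v *m X = 0 by rewrite -row_mul mulmx_ker row0.
  apply/rowP => j; rewrite [RHS]mxE; apply: (free (fun j => v 0 j)).
  set u := \sum_k _; have gu : in_graph a u by apply/span; exists (fun j => v 0 j).
  apply: injective_projections; first by rewrite -XE v0.
  have u1 : u.1 = 0 by rewrite -XE v0.
  apply/colP => l; rewrite -pairing_basis gu u1 mxE.
  have g0 : in_graph a 0 by apply/span; exists (fun=> 0); rewrite big1// => i _; rewrite scale0r.
  by rewrite -[a _]/(a [:: (0 : @gfiber R n).1; _]) -g0 /pairing mulmx0 mxE.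
have Xfull : row_full X.
  rewrite -sub1mx; apply/row_subP => k.
  have /span[c cE] := graph_vectorP (row k 1%:M) ma.
  apply/submxP; exists (\row_j c j); rewrite XE.
  by under eq_bigr do rewrite mxE; rewrite -cE.
by move: Xfree Xfull; rewrite /row_free /row_full => /eqP-> /eqP.
Qed.

Section Frame.
Context (U0 : set M) (m : M) (e : 'I_n -> M -> @gfiber R n).
Context (oU0 : open U0) (U0m : U0 m) (frame : smooth_frame A U0 e L).
Context (max_iso : forall x, U0 x -> isotropic (fiber_of L x)).

Let c := chart_at A m.
Let cm : chart_dom c m := chart_at_dom A m.
Let V0 := chart c @` (U0 `&` chart_dom c).
Let oV0 : open V0. Proof. exact: chart_image_open. Qed.

Let X y : 'M[R]_n := \matrix_(k, j) (section_coords c (e k) y).1 0 j.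
Let a y : 'M[R]_n := \matrix_(k, j) (section_coords c (e k) y).2 j 0.

Let XE y (v : 'rV[R]_n) :
  v *m X y = (\sum_k v 0 k *: section_coords c (e k) y).1.
Proof.
rewrite (raddf_sum (fst : {linear gfiber -> 'rV[R]_n})) mulmx_sum_row.
by apply: eq_bigr => k _ /=; congr (_ *: _); apply/rowP => j; rewrite !mxE.
Qed.

Let aE y (v : 'rV[R]_n) :
  (v *m a y)^T = (\sum_k v 0 k *: section_coords c (e k) y).2.
Proof.
rewrite (raddf_sum (snd : {linear gfiber -> 'cV[R]_n})) mulmx_sum_row raddf_sum.
by apply: eq_bigr => k _ /=; apply/colP => j; rewrite !mxE.
Qed.

Let X_smooth : smooth_mx V0 X.
Proof.
case: frame => se _ _ k j; apply: (@smooth_on_eq _ _ _ _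
  (fun y => (section_coords c (e k) y).1 0 j)) => //.
  by move=> y _; rewrite [RHS]mxE.
by apply: smooth_on_coord => //; exact: smooth_on_fst (se k c).
Qed.

Let a_smooth : smooth_mx V0 a.
Proof.
case: frame => se _ _ k j; apply: (@smooth_on_eq _ _ _ _
  (fun y => (section_coords c (e k) y).2 j 0)) => //.
  by move=> y _; rewrite [RHS]mxE.
by apply: smooth_on_coord => //; exact: smooth_on_snd (se k c).
Qed.

Lemma exists_transversal : exists S : {set 'I_n},
  mixed_mx S (X (chart c m)) (a (chart c m)) \in unitmx.
Proof.
have [_ free span] := frame.
have eL k : L (m, e k m).
  have : fiber_of L m (e k m); last by [].
  rewrite span//; exists (fun j => (j == k)%:R).
  rewrite (bigD1 k)//= eqxx scale1r big1 ?addr0// => j /negbTE ->.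
  by rewrite scale0r.
have eE k : section_coords c (e k) (chart c m) = tocoord c m (e k m).
  by rewrite section_coordsE chartK.
apply: isotropic_transversal.
  apply/matrixP => k l; have [_ iso] := max_iso U0m.
  have := iso _ _ (eL k) (eL l); rewrite -(isotropic_pairing_tocoord _ _ cm).
  rewrite /isotropic_pairing -!eE => /eqP; rewrite mulf_eq0 invr_eq0 pnatr_eq0 /=.
  rewrite /pairing !mxE => /eqP E; rewrite -[RHS]E; congr +%R.
    by apply: eq_bigr => j _; rewrite !mxE.
  by apply: eq_bigr => j _; rewrite !mxE mulrC.
move=> v vX va; apply/rowP => j; rewrite [RHS]mxE.
apply: (free m U0m (fun j => v 0 j)).
apply: (can_inj (tocoordK cm)); rewrite linear0 linear_sum.
under eq_bigr do rewrite linearZ /= -eE.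
by apply: injective_projections; [rewrite -XE vX|rewrite -aE va trmx0].
Qed.

Context (S : {set 'I_n}).
Context (G_unit : mixed_mx S (X (chart c m)) (a (chart c m)) \in unitmx).
Let G y := mixed_mx S (X y) (a y).

Let G_smooth : smooth_mx V0 G.
Proof.
move=> k i; have [iS|iS] := boolP (i \in S).
  by apply: smooth_on_eq (a_smooth k i) => // y _; rewrite [RHS]mxE iS.
by apply: smooth_on_eq (X_smooth k i) => // y _; rewrite [RHS]mxE (negbTE iS).
Qed.

Let W := [set x | [/\ U0 x, chart_dom c x & \det (G (chart c x)) != 0]].
Let oW : open W.
Proof.
apply: (open_chart_neq0 (g := fun y => \det (G y))) => // x Ux cx.
by apply: smooth_on_continuous (smooth_on_det oV0 G_smooth) _; exists x.
Qed.
Let Wm : W m.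
Proof. by split=> //; rewrite -unitfE -unitmxE. Qed.
Let Wc : W `<=` chart_dom c. Proof. by move=> x []. Qed.
Let V := chart c @` (W `&` chart_dom c).
Let oV : open V. Proof. exact: chart_image_open. Qed.
Let VV0 : V `<=` V0.
Proof. by move=> _ [x [[Ux _ _] cx] <-]; exists x. Qed.
Let GV y : V y -> G y \in unitmx.
Proof. by move=> [x [[_ _ dx] _] <-]; rewrite unitmxE unitfE. Qed.

Let D := chart c @` ((W `&` ~` Msing) `&` chart_dom c).
Let DV : D `<=` V.
Proof. by move=> _ [x [[? ?] ?] <-]; exists x. Qed.

Let eps y := exp_neg (local_form c w y).

(** Coefficients of the normalized frame: multiplying by the inverse of [G] turns the mixed
    components into the identity matrix ([GN]), as [spinor_smooth_ratio] requires. *)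
Let N y i : 'rV[R]_n := row i (invmx (G y)).
Let XN i y := N y i *m X y.
Let aN i y := (N y i *m a y)^T.

Let eps_alternating y : D y -> alternating_form (eps y).
Proof.
move=> [x [[Wx sx] cx] <-]; apply: exp_neg_alternating.
by rewrite /local_form chartK//; apply: pullback_alternating; exact: altw.
Qed.

Let GN y i : V y -> mixed_mx S (N y i *m X y) (N y i *m a y) = delta_mx 0 i.
Proof.
move=> Vy; rewrite -mul_mixed_mx /N -row_mul mulVmx; last exact: GV.
by apply/rowP => j; rewrite !mxE eqxx eq_sym.
Qed.

Lemma exists_smooth_ratio t : exists2 g : 'rV[R]_n -> R, smooth_on V g &
  forall y, D y -> eps y (map bv t) = g y * eps y (map bv (enum S)).
Proof.
have invG_smooth : smooth_mx V (fun y => invmx (G y)).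
  apply: smooth_mx_inv => //.
  by move=> k l; exact: smooth_on_sub VV0 (G_smooth k l).
have N_smooth i : smooth_mx V (N ^~ i).
  by move=> k l; apply: smooth_on_eq (invG_smooth i l) => // y _; rewrite mxE.
apply: (@spinor_smooth_ratio _ _ _ V D oV eps eps_alternating S XN aN).
- move=> i; apply: smooth_mxM => //.
  by move=> k l; exact: smooth_on_sub VV0 (X_smooth k l).
- move=> i k l; apply: (@smooth_on_eq _ _ _ _ (fun y => (N y i *m a y) l k)) => //.
    by move=> y _; rewrite [RHS]mxE.
  apply: smooth_mxM => // k' l'; exact: smooth_on_sub VV0 (a_smooth k' l').
- move=> i j y Dy jS; have /rowP/(_ j) := GN i (DV Dy).
  by rewrite !mxE (negbTE jS) eqxx /= eq_sym.
- move=> i j y Dy jS; have /rowP/(_ j) := GN i (DV Dy).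
  by rewrite [mixed_mx _ _ _ _ _]mxE jS !mxE eqxx /= eq_sym.
- move=> i _ s [x [[Wx sx] cx] <-]; have [Ux _ _] := Wx.
  rewrite /eps /local_form chartK//.
  apply: clifford_exp_neg.
  + exact: pullback_alternating (altw sx).
  + exact: pullback_homogeneous (homw sx).
  rewrite /XN /aN XE aE -surjective_pairing.
  apply: in_graph_sum; first by case: (pullback_alternating
    (cjac c (chart_at A x) x) (altw sx)).
  move=> k; rewrite section_coordsE chartK//; apply/(in_graph_coord _ _ cx).
  apply/(isotropic_fiber_regular _ (max_iso Ux) sx).
  have [_ _ span] := frame.
  have : fiber_of L x (e k x); last by [].
  rewrite span//; exists (fun j => (j == k)%:R).
  rewrite (bigD1 k)//= eqxx scale1r big1 ?addr0// => j /negbTE ->.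
  by rewrite scale0r.
Qed.

(** The ratios [P t] are extended separately for each [t]. Relations between them, such as
    alternation or the value 1 at [enum S], are therefore known only at regular points at first and
    are carried over by density. *)
Lemma exists_spinor : exists (U : set M) (f : M -> R) (rho : M -> preform),
  [/\ open U, U m, smooth_function A U f, differential_form A U rho &
    (forall x, U x -> ~ Msing x -> forall s, rho x s = f x * exp_neg (w x) s) /\
    (forall x, U x -> exists s, rho x s != 0)].
Proof.
have [P PP] := choice (fun t => let: ex_intro2 g gs gE := exists_smooth_ratio t in
  ex_intro (fun g : 'rV[R]_n -> R => smooth_on V g /\ forall y, D y ->
    eps y (map bv t) = g y * eps y (map bv (enum S))) g (conj gs gE)).
have P_smooth t : smooth_on V (P t) by case: (PP t).
have PE t y : D y -> eps y (map bv t) = P t y * eps y (map bv (enum S)).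
  by case: (PP t) => _; exact.
(* The degree zero part of e^{-w} is 1. Hence at regular points the component along [S] is nonzero
   and [P [::]] is its inverse. *)
have P1 y : D y -> P [::] y * eps y (map bv (enum S)) = 1.
  move=> Dy; rewrite -PE//; case: Dy => x [[Wx sx] cx] <-.
  rewrite /eps /local_form chartK//; apply: exp_neg_nil.
  exact: pullback_homogeneous (homw sx).
pose rc y : preform := mlext (fun t => P t y).
have rcE y s : D y -> rc y s = P [::] y * eps y s.
  move=> Dy; rewrite (@mlextE _ _ (eps y)); last by case: (eps_alternating Dy).
  rewrite -mlextZ; apply: eq_mlext => t _.
  by rewrite PE// mulrCA P1// mulr1.
have rc_smooth s : smooth_on V (fun y => rc y s).
  have := @smooth_mlext _ _ _ V _ (fun y t => P t y) (fun _ v => v) s oV P_smooth.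
  rewrite map_id; apply => v k l; exact: smooth_on_cst.
have dense_eq x (g : 'rV[R]_n -> R) : W x -> smooth_on V g ->
    (forall y, D y -> g y = 0) -> g (chart c x) = 0.
  move=> Wx sg g0; have cx := Wc Wx.
  apply: (dense_chart_eq Msing_dense oW Wx cx).
    by apply: smooth_on_continuous sg _; exists x.
  by move=> z Wz cz sz; apply: g0; exists z.
have rc_alt x : W x -> alternating_form (rc (chart c x)).
  move=> Wx; split.
    move=> s1 s2 t u v; apply/eqP; rewrite -subr_eq0; apply/eqP.
    apply: (dense_eq x (fun y => rc y (s1 ++ (t *: u + v) :: s2) -
      (t * rc y (s1 ++ u :: s2) + rc y (s1 ++ v :: s2)))) => //.
      apply: smooth_onD => //; apply: smooth_onN => //; apply: smooth_onD => //.
      by apply: smooth_onM => //; exact: smooth_on_cst.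
    move=> y Dy; rewrite !rcE//; have [-> _] := eps_alternating Dy.
    by ring.
  move=> s1 s2 s3 u; apply: (dense_eq x (fun y => rc y (s1 ++ u :: s2 ++ u :: s3))) => //.
  by move=> y Dy; rewrite rcE//; have [_ ->] := eps_alternating Dy; rewrite mulr0.
(* Back from chart [c] to the preferred trivialization at each point. *)
pose rho x := pullback (cjac (chart_at A x) c x) (rc (chart c x)).
exists W, (fun x => P [::] (chart c x)), rho; split=> //.
- apply: (smooth_function_chart (c := c)) => //.
  apply: smooth_on_eq (P_smooth [::]) => // y; rewrite inE => -[x [Wx cx] <-].
  by rewrite /= chartK.
- apply: (differential_form_chart (c := c)) => //.
    by move=> x Wx; apply: pullback_alternating; exact: rc_alt.
  move=> t; apply: smooth_on_eq (P_smooth t) => // y; rewrite inE => -[x [Wx cx] <-].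
  by rewrite chartK// /rho fcoord_pullback// /rc mlext_basis.
- split=> [x Wx sx s|x Wx]; have cx := Wc Wx.
    have Dx : D (chart c x) by exists x.
    rewrite /rho /pullback rcE//; congr *%R.
    rewrite -[LHS]/(pullback _ (eps (chart c x)) s) /eps pullback_exp_neg.
    congr (exp_neg _ s); apply/funext => s'.
    by rewrite /local_form chartK// fcoordK.
  (* The coordinate vectors of chart [c] indexed by [S]: the component of [rho] along them is 1,
     first at regular points and then on [W] by density. *)
  exists [seq v *m cjac c (chart_at A x) x | v <- map bv (enum S)].
  have : fcoord c x (rho x) (map bv (enum S)) = 1; last first.
    by rewrite /fcoord /pullback => ->; exact: oner_neq0.
  rewrite fcoord_pullback// /rc mlext_basis; apply/eqP; rewrite -subr_eq0; apply/eqP.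
  apply: (dense_eq x (fun y => P (enum S) y - 1)) => //.
    by apply: smooth_onD => //; exact: smooth_on_cst.
  move=> y Dy; have := PE (enum S) y Dy; have := P1 y Dy.
  have [->|e0 _] := eqVneq (eps y (map bv (enum S))) 0.
    by rewrite mulr0 => /esym/eqP; rewrite oner_eq0.
  rewrite -[LHS]mul1r => /(mulIf e0) <-; exact: subrr.
Qed.

End Frame.

Lemma removable_spinor m : removable A Msing w m ->
  exists (U : set M) (f : M -> R) (rho : M -> preform),
  [/\ open U, U m, smooth_function A U f, differential_form A U rho &
    (forall x, U x -> ~ Msing x -> forall s, rho x s = f x * exp_neg (w x) s) /\
    (forall x, U x -> exists s, rho x s != 0)].
Proof.
move=> [W [oW Wm [sub max _]]].
have [U [oU Um UW [r [e frame]]]] := sub m Wm.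
have iso x : U x -> isotropic (fiber_of L x) by move=> /UW/max[].
(* The rank is read off at a regular point of [U], where the fibre is known to be a graph. *)
have [|x [Ux sx]] := Msing_dense _ oU; first by exists m.
have rn : r = n.
  have [_ free span] := frame.
  apply: (@frame_rank r (fun k => e k x) (w x) (altw sx) (free x Ux)) => u.
  rewrite -(isotropic_fiber_regular _ (iso x Ux) sx).
  by rewrite -[L (x, u)]/(fiber_of L x u) span.
move: e frame; rewrite rn => e frame.
have [S Su] := exists_transversal Um frame iso.
exact: exists_spinor oU Um frame iso S Su.
Qed.

End DiracToSpinor.

Theorem proposition2p10 (R : realType) (n : nat) (n_ge2 : (2 <= n)%N)
  (M : topologicalType) (A : smooth_manifold R n M)
  (Msing : set M) (Msing_closed : closed Msing) (Msing_dense : dense (~` Msing))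
  (w : M -> seq 'rV[R]_n -> R)
  (w_2form : differential_kform A 2 (~` Msing) w)
  (w_closed : closed_form A (~` Msing) w)
  (m : M) (m_sing : has_singularity A Msing w m) :
  removable A Msing w m <->
  exists (U : set M) (f : M -> R) (rho : M -> seq 'rV[R]_n -> R),
    [/\ open U, U m, smooth_function A U f, differential_form A U rho &
        (forall x, U x -> ~ Msing x ->
           forall s, rho x s = f x * exp_neg (w x) s) /\
        (forall x, U x -> exists s, rho x s != 0)].
Proof.
split; first exact: removable_spinor.
move=> [U [f [rho [oU Um _ rho_form [rhoE rho0]]]]].
have [t0 t0m] := exists_leading_index Um rho_form (rho0 m Um).
(* The frame divides by the component along [t0], so the neighbourhood is cut down to where it stays
   nonzero. *)
exists [set x | [/\ U x, chart_dom (chart_at A m) x &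
  local_form (chart_at A m) rho (chart (chart_at A m) x)
    (map basis_vector t0) != 0]].
split.
- exact: leading_open oU rho_form t0.
- by split=> //; exact: chart_at_dom.
- exact: (closure_dirac Msing_closed Msing_dense w_2form w_closed m oU rho_form rhoE t0).
Qed.
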